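(* Let $m>n\ge2$ be coprime integers. Then $\mathcal F^{ind}_iL_{m/n}\subset\mathcal F^{alg}_iL_{m/n}$ for all $i$.
   Context: Let $c=m/n$ and let $R\subset\mathbb C[x_1,\dots,x_n]$ be the subring generated by the differences $x_i-x_j$. The rational Cherednik algebra $\mathbf H_c$ of type $\mathfrak{sl}_n$ is generated by $S_n$, $\mathfrak h^*=\mathrm{span}\{x_i-x_j\}$ and $\mathfrak h=\mathrm{span}\{y_i-y_j\}$ with relations $[x,x']=0$, $[y,y']=0$, $sxs^{-1}=s(x)$, $sys^{-1}=s(y)$ and $[y,x]=\langle y,x\rangle-c\sum_{i<j}\langle y,x_i-x_j\rangle\langle y_i-y_j,x\rangle s_{ij}$, where $\langle y_i,x_j\rangle=\delta_{ij}$. It acts on $R$: $S_n$ permutes variables, $x\in\mathfrak h^*$ acts by multiplication, $y_i-y_j$ acts as $D_i-D_j$, $D_i=\frac{\partial}{\partial x_i}+c\sum_{j\ne i}\frac{s_{ij}-1}{x_i-x_j}$. For coprime $m,n>0$, $\mathbf H_{m/n}$ has a unique finite-dimensional irreducible representation $L_{m/n}=R/I_{m/n}$, with $I_{m/n}$ an ideal generated by homogeneous polynomials of degree $m$. Internal grading: the image of a homogeneous polynomial of degree $r$ has degree $r-(m-1)(n-1)/2$; $L_{m/n}(k)$ is the part of degree $k$. $\mathbf e=\frac1{n!}\sum_{s}s$, $\mathbf e_-=\frac1{n!}\sum_s\mathrm{sign}(s)s$. $\mathcal G_i\mathbf H_c$ is the span of products containing at most $i$ factors from $\mathfrak h\cup\mathfrak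 h^*$ and any number of elements of $S_n$; a filtration of a module is compatible if $\mathcal G_i\mathcal F_j\subset\mathcal F_{i+j}$ (for $\mathbf eL_{m/n}$, as an $\mathbf e\mathbf H_{m/n}\mathbf e$-module). All filtrations have steps spanned by homogeneous elements. Inductive filtration $\mathcal F^{ind}$: the unique system of compatible increasing filtrations on $L_{m/n}$ ($m>n$, $n\ge2$) and $\mathbf eL_{m/n}$ ($m>0$, $n\ge 2$), restricting to one another when $m>n$, such that (1) $0=\mathcal F_{-1}\subset\mathcal F_0=\mathbf eL_{1/n}$; (2) the canonical isomorphisms $\mathbf eL_{m/n}\cong\mathbf eL_{n/m}$ ($m,n\ge 2$) and $\mathbf eL_{m/n}\cong\mathbf e_-L_{(m+n)/n}$ preserve filtrations; (3) for $m>n$ the multiplication isomorphism $\mathbf H_{m/n}\mathbf e_-\otimes_{\mathbf e_-\mathbf H_{m/n}\mathbf e_-}\mathbf e_-L_{m/n}\to L_{m/n}$ is an isomorphism of filtered spaces (tensor product filtration on the left). Here $\mathbf eL_{m/n}\to\mathbf e_-L_{(m+n)/n}$ is multiplication by the Vandermonde determinant $W=\prod_{i<j}(x_i-x_j)$, and $\mathbf eL_{m/n}\cong\mathbf eL_{n/m}$ is the ring isomorphism sending the class of $\sum_{i=1}^n(x_i-\bar x)^k$ to $\frac nm$ times the class of $\sum_{i=1}^m(\tilde x_i-\bar{\tilde x})^k$ for all $k\geq1$ (bars are averages, $\tilde x_i$ the variables for $L_{n/m}$). Algebraic filtration: let $\mathfrak a\subset R$ be the ideal generated by the $S_n$-invariants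 of positive degree, write $\mathfrak a^j$ also for its image in $L_{m/n}$, and put $\mathcal F^iL_{m/n}=\sum_{j\ge0}\big(\mathfrak a^j\cap\bigoplus_{k<2j-i}L_{m/n}(k)\big)$. The Dunkl form $(f,g)_c=[\Phi(f)\cdot g]|_{x=0}$, where $\Phi(f)$ is obtained from $f$ by substituting $D_i$ for $x_i$, descends to a nondegenerate symmetric form on $L_{m/n}$, and $\mathcal F^{alg}_iL_{m/n}:=(\mathcal F^iL_{m/n})^\perp$. *)

(* Defs.v *)
From HB Require Import structures.
From mathcomp Require Import all_boot all_order all_algebra fingroup perm.
From mathcomp Require Import classical_sets reals complex.
From mathcomp Require Import mpoly.

Set Implicit Arguments.
Unset Strict Implicit.
Unset Printing Implicit Defensive.

Import GRing.Theory Num.Theory.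

Local Open Scope classical_set_scope.
Local Open Scope ring_scope.

(* Conventions.
   - The field of complex numbers is R[i] for a realType R.
   - L_{m/n} is the quotient R / I of the ring R of polynomials in the
     differences x_i - x_j (called diff_ring below, to avoid a clash with the
     real numbers).  A subspace of a quotient by I is represented by its
     preimage, i.e. by a subspace U of diff_ring with I `<=` U `<=` diff_ring;
     inclusions, sums, intersections and images of subspaces of the quotient
     correspond to those of the preimages.
   - H_c enters only through its action on diff_ring and its quotients, so its
     elements are represented by formal linear combinations of words in the
     generators, acting by the prescribed operators. *)

Section LinearAlgebra.
Variables (K : nzRingType) (V : lmodType K).

Definition is_subspace (U : set V) :=
  [/\ U 0, forall u v, U u -> U v -> U (u + v)
    & forall (a : K) u, U u -> U (a *: u)].

Inductive lspan (A : set V) : set V :=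
| lspan0 : lspan A 0
| lspan_in v of A v : lspan A v
| lspanD u v of lspan A u & lspan A v : lspan A (u + v)
| lspanZ (a : K) v of lspan A v : lspan A (a *: v).

(* Preimage of the image of A in the quotient by I. *)
Definition mod_sat (I A : set V) : set V :=
  [set v | exists2 u, A u & I (v - u)].

End LinearAlgebra.

Section Polynomials.
Variables (R : realType) (n : nat).
Local Notation C := R[i].
Local Notation P := {mpoly C[n]}.

Inductive diff_ring : set P :=
| diff_ringC (a : C) : diff_ring a%:MP
| diff_ringX (i j : 'I_n) : diff_ring ('X_i - 'X_j)
| diff_ringD f g of diff_ring f & diff_ring g : diff_ring (f + g)
| diff_ringM f g of diff_ring f & diff_ring g : diff_ring (f * g).

Definition sym_idem (f : P) : P :=
  (n`!%:R)^-1 *: \sum_(s : 'S_n) msym s f.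

Definition sign_idem (f : P) : P :=
  (n`!%:R)^-1 *: \sum_(s : 'S_n) (-1) ^+ s *: msym s f.

(* (s_ij f - f) / (x_i - x_j), an exact division by ddiffP. *)
Definition ddiff (i j : 'I_n) (f : P) : P :=
  xget 0 [set q : P | q * ('X_i - 'X_j) = msym (tperm i j) f - f].

Lemma ddiffP i j f : ddiff i j f * ('X_i - 'X_j) = msym (tperm i j) f - f.
Proof.
suff [q Hq] : exists q : P, q * ('X_i - 'X_j) = msym (tperm i j) f - f.
  by rewrite /ddiff; case: xgetP => [r _ //|noq]; case: (noq q).
pose Q (g : P) := exists q : P, q * ('X_i - 'X_j) = msym (tperm i j) g - g.
have QD g h : Q g -> Q h -> Q (g + h).
  move=> [q Hq] [r Hr]; exists (q + r).
  by rewrite mulrDl Hq Hr msymD opprD addrACA.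
have QM g h : Q g -> Q h -> Q (g * h).
  move=> [q Hq] [r Hr]; exists (q * h + r * msym (tperm i j) g).
  rewrite mulrDl mulrAC Hq [r * _ * _]mulrAC Hr msymM !mulrBl.
  by rewrite [msym _ h * _]mulrC [h * _]mulrC addrC addrA addrNK.
have QZ c g : Q g -> Q (c *: g).
  by move=> [q Hq]; exists (c *: q); rewrite -scalerAl Hq msymZ scalerBr.
have Q0 : Q 0 by exists 0; rewrite mul0r msym0 subrr.
have Q1 : Q 1 by exists 0; rewrite mul0r msym1 subrr.
have QX k : Q 'X_k.
  rewrite /Q /msym mmapX mmap1U; case: tpermP => [->|->|_ _].
  - by exists (- 1); rewrite mulN1r opprB.
  - by exists 1; rewrite mul1r.
  - by exists 0; rewrite mul0r subrr.
rewrite -/(Q f) [f]mpolyE; apply: (big_ind Q) => // u _; apply: QZ.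
rewrite mpolyXE_id; apply: (big_ind Q) => // k _.
by elim: (u k) => [|d IHd]; rewrite ?expr0 // exprS; apply: QM.
Qed.

Definition dunkl (c : C) (i : 'I_n) (f : P) : P :=
  mderiv i f + c *: \sum_(j < n | j != i) ddiff i j f.

Inductive ch_gen :=
| GS of 'S_n
| GX of 'I_n & 'I_n
| GY of 'I_n & 'I_n.

Definition gen_act (c : C) (g : ch_gen) (f : P) : P :=
  match g with
  | GS s => msym s f
  | GX i j => ('X_i - 'X_j) * f
  | GY i j => dunkl c i f - dunkl c j f
  end.

Definition gen_deg (g : ch_gen) : nat := if g is GS _ then 0 else 1.

Definition ch_elt := seq (C * seq ch_gen).

Definition ch_act (c : C) (h : ch_elt) (f : P) : P :=
  \sum_(aw <- h) aw.1 *: foldr (gen_act c) f aw.2.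

(* Since h and h^* are spanned by the y_i - y_j and the x_i - x_j, this gives
   the step G_k of the filtration of H_c. *)
Definition ch_filt (k : nat) : set ch_elt :=
  [set h | all (fun aw => sumn (map gen_deg aw.2) <= k)%N h].

Definition ch_submodule (c : C) (U : set P) :=
  [/\ is_subspace U, U `<=` diff_ring
    & forall g f, U f -> U (gen_act c g f)].

(* W *)
Definition vander : P :=
  \prod_(i < n) \prod_(j < n | (i < j)%N) ('X_i - 'X_j).

Definition psum (k : nat) : P :=
  \sum_(i < n) ('X_i - (n%:R : C)^-1 *: \sum_(j < n) 'X_j) ^+ k.

Definition pos_invariant : set P :=
  [set f | [/\ diff_ring f, f \is symmetric
    & exists2 d : nat, (0 < d)%N & f \is d.-homog]].

Definition coinv_ideal : set P :=
  lspan [set p | exists r f, [/\ diff_ring r, pos_invariant f & p = r * f]].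

Fixpoint coinv_pow (j : nat) : set P :=
  if j is j'.+1 then
    lspan [set p | exists f g,
      [/\ coinv_ideal f, coinv_pow j' g & p = f * g]]
  else diff_ring.

(* Phi(f) g, with D_i substituted for x_i; the D_i commute, so the order in
   which they are applied to g is irrelevant. *)
Definition dunkl_subst (c : C) (f g : P) : P :=
  \sum_(u <- msupp f)
    f@_u *: foldr (fun i h => iter (u i) (dunkl c i) h) g (enum 'I_n).

Definition dunkl_form (c : C) (f g : P) : C :=
  (dunkl_subst c f g).@[fun=> 0].

End Polynomials.

Section Representation.
Variables (R : realType) (m n : nat).
Local Notation C := R[i].
Local Notation P := {mpoly C[n]}.

Definition slope : C := m%:R / n%:R.

(* (m-1)(n-1) is even when m and n are coprime. *)
Definition top_shift : nat := (m.-1 * n.-1)./2.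

(* diff_ring / I is the representation L_{m/n}. *)
Record is_Lideal (I : set P) : Prop := IsLideal {
  Lideal_sub : ch_submodule slope I;
  Lideal_fin : exists s : seq P, (forall p, p \in s -> diff_ring p) /\
    forall f, diff_ring f -> mod_sat I (lspan [set` s]) f;
  Lideal_proper : I <> @diff_ring R n;
  Lideal_irr : forall J : set P, ch_submodule slope J -> I `<=` J ->
    J = I \/ J = @diff_ring R n;
  Lideal_gen : I = lspan [set p | exists r g,
    [/\ diff_ring r, I g, g \is m.-homog & p = r * g]] }.

Variable I : set P.

Definition Lgrade (k : int) : set P :=
  mod_sat I [set f | diff_ring f /\
    forall u, u \in msupp f -> (mdeg u)%:Z - top_shift%:Z = k].

Definition eL : set P := [set f | diff_ring f /\ I (sym_idem f - f)].

Definition eminusL : set P := [set f | diff_ring f /\ I (sign_idem f - f)].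

Record filtration_of (L : set P) (F : int -> set P) : Prop := FiltrationOf {
  filt_subspace : forall i, is_subspace (F i);
  filt_ideal : forall i, I `<=` F i;
  filt_sub : forall i, F i `<=` L;
  filt_increasing : forall i j, i <= j -> F i `<=` F j;
  filt_homog : forall i, F i = lspan (F i `&` \bigcup_k Lgrade k) }.

Definition compatible (F : int -> set P) :=
  filtration_of (@diff_ring R n) F /\
  forall (a : nat) (j : int) h f, ch_filt a h -> F j f ->
    F (a%:Z + j) (ch_act slope h f).

(* The filtration of e H_c e is given by the e G_a e. *)
Definition sph_compatible (F : int -> set P) :=
  filtration_of eL F /\
  forall (a : nat) (j : int) h f, ch_filt a h -> F j f ->
    F (a%:Z + j) (sym_idem (ch_act slope h (sym_idem f))).

(* Image under the multiplication map of the i-th step of the tensor product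
   filtration on H_c e_- (x) e_- L, where H_c e_- is filtered by the G_a e_-
   and e_- L by the F_b `&` e_- L. *)
Definition tensor_filt (F : int -> set P) (i : int) : set P :=
  mod_sat I (lspan [set p | exists (a : nat) (b : int) h v,
    [/\ a%:Z + b = i, ch_filt a h, F b v, eminusL v
      & p = ch_act slope h (sign_idem v)]]).

(* The decreasing filtration F^i. *)
Definition dec_filt (i : int) : set P :=
  lspan (\bigcup_j (mod_sat I (coinv_pow j) `&`
    lspan (\bigcup_(k in [set k : int | k < 2 * j%:Z - i]) Lgrade k))).

Definition alg_filt (i : int) : set P :=
  [set f | diff_ring f /\
    forall g, dec_filt i g -> dunkl_form slope f g = 0].

End Representation.

Section InductiveFiltration.
Variable R : realType.
Local Notation C := R[i].

(* Graph of the algebra isomorphism e L_{m/n} -> e L_{n/m} sending the class of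
   psum n k to n/m times the class of psum m k: these classes generate
   e L_{m/n}, so the graph is the subalgebra of the product generated by the
   pairs of corresponding generators. *)
Inductive canon_iso (m n : nat) (I : set {mpoly C[n]}) (I' : set {mpoly C[m]}) :
  {mpoly C[n]} -> {mpoly C[m]} -> Prop :=
| canon_gen k of (0 < k)%N :
    canon_iso I I' (psum R n k) ((n%:R / m%:R : C) *: psum R m k)
| canonC (a : C) : canon_iso I I' a%:MP a%:MP
| canonD f g f' g' of canon_iso I I' f f' & canon_iso I I' g g' :
    canon_iso I I' (f + g) (f' + g')
| canonM f g f' g' of canon_iso I I' f f' & canon_iso I I' g g' :
    canon_iso I I' (f * g) (f' * g')
| canon_mod u u' of I u & I' u' : canon_iso I I' u u'.

Definition poly_family := forall m n : nat, set {mpoly C[n]}.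
Definition filt_family := forall m n : nat, int -> set {mpoly C[n]}.

(* F m n is a filtration of L_{m/n} (only meaningful for m > n >= 2) and E m n
   a filtration of e L_{m/n} (m > 0, n >= 2), m and n coprime. *)
Record inductive_filtration (I : poly_family) (F E : filt_family) : Prop :=
  InductiveFiltration {
  ind_compatible : forall m n, (1 < n)%N -> (n < m)%N -> coprime m n ->
    compatible m (I m n) (F m n);
  ind_sph_compatible : forall m n, (1 < n)%N -> (0 < m)%N -> coprime m n ->
    sph_compatible m (I m n) (E m n);
  ind_restrict : forall m n, (1 < n)%N -> (n < m)%N -> coprime m n ->
    forall i, E m n i = F m n i `&` eL (I m n);
  ind_base : forall n, (1 < n)%N ->
    E 1 n (-1) = I 1 n /\ E 1 n 0 = eL (I 1 n);
  ind_duality : forall m n, (1 < n)%N -> (1 < m)%N -> coprime m n ->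
    forall f g, canon_iso (I m n) (I n m) f g ->
    forall i, E m n i f <-> E n m i g;
  ind_shift : forall m n, (1 < n)%N -> (0 < m)%N -> coprime m n ->
    forall f, diff_ring f -> f \is symmetric ->
    forall i, E m n i f <-> F (m + n)%N n i (vander R n * f);
  ind_tensor : forall m n, (1 < n)%N -> (n < m)%N -> coprime m n ->
    forall i, F m n i = tensor_filt m (I m n) (F m n) i }.

End InductiveFiltration.

(* Main.v *)
(* Let [A i] be the set of those f in R that are orthogonal, for the Dunkl form,
   to all homogeneous elements of a^j of internal degree < 2j - i.  Its image in
   L_{m/n} is the i-th step of the algebraic filtration.  Since the form
   exchanges multiplication by x_i and D_i, and since D_i maps a^j into a^{j-1},
   the [A i] are compatible with the filtration of H_c.  By condition (3) it is
   therefore enough to treat e_- L_{m/n}, and by (2) this reduces to a statement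
   on e L_{(m-n)/n}, namely orthogonality to the powers of the ideal of positive
   invariants, which follows inductively from two compatibilities of the form:
   - with multiplication by W: (W f, W g)_{c+1} = (W, W)_{c+1} (f, g)_c for
     symmetric f and g;
   - with the duality m/n <-> n/m, up to a factor (m/n)^deg.
   Both follow from the corresponding property of the single operator
   H = sum_i D_i^2 on symmetric polynomials, because (ad H)^d applied to the
   multiplication by a homogeneous polynomial b of degree d is 2^d d! times
   b(D_1, ..., D_n).  For m = 1 the statement holds for degree reasons, positive
   invariants in R having degree at least 2. *)
From HB Require Import structures.
Require Import Defs.
From mathcomp Require Import all_boot all_order all_algebra fingroup perm.
From mathcomp Require Import classical_sets reals complex ssrcomplements mpoly.
From mathcomp Require Import ring zify.

Set Implicit Arguments.
Unset Strict Implicit.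
Unset Printing Implicit Defensive.

Import GRing.Theory Num.Theory.

Local Open Scope classical_set_scope.
Local Open Scope ring_scope.

(** The induction has the shape of the subtractive Euclidean algorithm: division by W replaces (m,
    n) by (m - n, n), and duality swaps the two. It closes because the index i never changes: deg W
    = n(n-1)/2 is exactly the difference between the degree shifts of L_{m/n} and L_{(m-n)/n}, and
    the shift is symmetric in m and n. The obstacle is that b(D_1, ..., D_n) is not visibly
    compatible with either isomorphism: a single D_i does not preserve symmetric polynomials, and
    the duality relates rings in different numbers of variables. H does preserve them, and it can be
    computed both on products W f and in terms of power sums. The descent from L to e L works
    because positive invariants pass through antisymmetrisation: applied to a^j it yields W times
    the j-th power of the ideal of positive invariants inside the ring of invariants. *)

(** * Dunkl operators *)

(* Over R[i] itself unification is prohibitively slow, hence these locked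
   copies of [ddiff], [dunkl], etc. over a general field; they are identified
   with the originals in the section [Translation]. *)
HB.lock Definition divdiff (K : numFieldType) (n : nat) (i j : 'I_n)
    (f : {mpoly K[n]}) : {mpoly K[n]} :=
  xget 0 [set q | q * ('X_i - 'X_j) = msym (tperm i j) f - f].

HB.lock Definition dunkl_op (K : numFieldType) (n : nat) (c : K) (i : 'I_n)
    (f : {mpoly K[n]}) : {mpoly K[n]} :=
  f^`M(i) + c *: \sum_(j < n | j != i) divdiff i j f.

Section Dunkl.
Variables (K : numFieldType) (n : nat).
Local Notation P := {mpoly K[n]}.
Implicit Types (f g h q : P) (c : K) (i j k l : 'I_n) (s : 'S_n).

(** Linear identities between operators are checked on 1 and propagated by their commutation
    relations with the variables. *)
Lemma mpoly_ind_X (Q : P -> Prop) :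
  (forall f g, Q f -> Q g -> Q (f + g)) -> (forall a f, Q f -> Q (a *: f)) ->
  Q 1 -> (forall k f, Q f -> Q ('X_k * f)) -> forall f, Q f.
Proof.
move=> QD QZ Q1 QX f; rewrite [f]mpolyE.
have Q0 : Q 0 by rewrite -(scale0r 1); apply: QZ.
apply: (big_ind Q) => // u _; apply: QZ.
rewrite mpolyXE_id; elim: (index_enum _) => [|k r IHr];
  first by rewrite big_nil.
rewrite big_cons; elim: (u k) => [|d IHd]; first by rewrite expr0 mul1r.
by rewrite exprS -mulrA; apply: QX.
Qed.

Lemma mpolyX_sub_neq0 i j : i != j -> 'X_i - 'X_j != 0 :> P.
Proof.
move=> nij; apply/eqP => /(congr1 (mcoeff U_(i))).
rewrite mcoeffB !mcoeffXU eqxx eq_sym (negbTE nij) subr0 mcoeff0 => /eqP.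
by rewrite oner_eq0.
Qed.

Lemma msymXU s i : msym s 'X_i = 'X_(s i) :> P.
Proof. by rewrite /msym mmapX mmap1U. Qed.

Lemma msymC s (a : K) : msym s a%:MP = a%:MP :> P.
Proof. by rewrite /msym mmapC. Qed.

Lemma divdiff_subproof i j f : exists q : P, q * ('X_i - 'X_j) =
  msym (tperm i j) f - f.
Proof.
elim/mpoly_ind_X: f => [f g [q Hq] [r Hr]|a f [q Hq]||k f [q Hq]].
- by exists (q + r); rewrite mulrDl Hq Hr msymD; ring.
- by exists (a *: q); rewrite -scalerAl Hq msymZ scalerBr.
- by exists 0; rewrite mul0r msym1 subrr.
- suff [r Hr] : exists r : P, r * ('X_i - 'X_j) = 'X_(tperm i j k) - 'X_k.
    exists (q * 'X_(tperm i j k) + r * f).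
    by rewrite msymM msymXU mulrDl mulrAC Hq [r * f * _]mulrAC Hr; ring.
  case: tpermP => [->|->|_ _].
  + by exists (- 1); rewrite mulN1r opprB.
  + by exists 1; rewrite mul1r.
  + by exists 0; rewrite mul0r subrr.
Qed.

Lemma divdiffP i j f : divdiff i j f * ('X_i - 'X_j) = msym (tperm i j) f - f.
Proof.
rewrite divdiff.unlock; case: xgetP => [r _ //|noq].
by have [q Hq] := divdiff_subproof i j f; case: (noq q).
Qed.

Lemma dunkl_opE c i f :
  dunkl_op c i f = f^`M(i) + c *: \sum_(j < n | j != i) divdiff i j f.
Proof. by rewrite dunkl_op.unlock. Qed.

Lemma divdiff_eq i j f q : i != j ->
  q * ('X_i - 'X_j) = msym (tperm i j) f - f -> divdiff i j f = q.
Proof.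
move=> nij e; apply: (mulIf (mpolyX_sub_neq0 nij)).
by rewrite divdiffP.
Qed.

Lemma divdiff_is_linear i j : i != j -> linear (divdiff i j : P -> P).
Proof.
move=> nij a f g; apply: divdiff_eq nij _.
by rewrite mulrDl -scalerAl !divdiffP msymD msymZ scalerBr opprD addrACA.
Qed.

Lemma divdiffD i j : i != j -> {morph divdiff i j : f g / f + g : P >-> f + g}.
Proof. by move=> nij f g; have := divdiff_is_linear nij 1 f g;
  rewrite !scale1r. Qed.

Lemma divdiffZ i j (a : K) : i != j ->
  {morph divdiff i j : f / a *: f : P >-> a *: f}.
Proof.
move=> nij f; apply: divdiff_eq => //.
by rewrite -scalerAl divdiffP msymZ scalerBr.
Qed.

Lemma divdiffC i j f : i != j -> divdiff j i f = - divdiff i j f.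
Proof.
move=> nij; apply: divdiff_eq; first by rewrite eq_sym.
by rewrite mulNr -mulrN opprB divdiffP tpermC.
Qed.

Lemma divdiff_sym i j f : i != j -> msym (tperm i j) f = f -> divdiff i j f = 0.
Proof. by move=> nij e; apply: divdiff_eq => //; rewrite mul0r e subrr. Qed.

Lemma divdiffMr i j f g : i != j ->
  divdiff i j (f * g) = divdiff i j f * g + msym (tperm i j) f * divdiff i j g.
Proof.
move=> nij; apply: divdiff_eq => //; rewrite mulrDl mulrAC divdiffP.
by rewrite -mulrA divdiffP msymM; ring.
Qed.

Lemma divdiffMl i j f g : i != j ->
  divdiff i j (f * g) = divdiff i j f * msym (tperm i j) g + f * divdiff i j g.
Proof.
move=> nij; apply: divdiff_eq => //; rewrite mulrDl mulrAC divdiffP.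
by rewrite -mulrA divdiffP msymM; ring.
Qed.

Lemma divdiffX i j k : i != j ->
  divdiff i j ('X_k : P) = ((k == j)%:R - (k == i)%:R)%:MP.
Proof.
move=> nij; apply: divdiff_eq => //; rewrite msymXU.
case: tpermP => [->|->|/eqP nki /eqP nkj].
- by rewrite (negbTE nij) eqxx sub0r mpolyCN mpolyC1 mulN1r opprB.
- by rewrite eqxx eq_sym (negbTE nij) subr0 mpolyC1 mul1r.
- by rewrite (negbTE nki) (negbTE nkj) subrr mpolyC0 mul0r subrr.
Qed.

Lemma divdiffJ s i j f : i != j ->
  msym s (divdiff i j f) = divdiff (s i) (s j) (msym s f).
Proof.
move=> nij; apply/esym/divdiff_eq; first by rewrite (inj_eq perm_inj).
rewrite -!(msymXU s) -msymB -msymM divdiffP msymB -!msymMm;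
  congr (msym _ f - _).
by rewrite -tpermJ conjgE !mulgA mulgV mul1g.
Qed.

Lemma mderivX1 i k : ('X_k)^`M(i) = (k == i)%:R%:MP :> P.
Proof.
rewrite mderivX mnm1E -mul_mpolyC; case: eqP => [->|_]; last first.
  by rewrite mpolyC0 mul0r.
by have -> : (U_(i) - U_(i))%MM = 0%MM
  by [apply/mnmP => l; rewrite mnmBE mnm0E subnn]; rewrite mpolyX0 mulr1.
Qed.

Lemma mderivJ s i f : msym s f^`M(i) = (msym s f)^`M(s i).
Proof.
apply/mpolyP => u; rewrite mcoeff_sym !mcoeff_deriv mcoeff_sym mnmE.
congr (mcoeff _ _ *+ _); apply/mnmP => l; rewrite !mnmE.
by rewrite (inj_eq perm_inj).
Qed.

Lemma dunkl_op_is_linear c i : linear (dunkl_op c i : P -> P).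
Proof.
move=> a f g; rewrite !dunkl_opE linearP /=.
under eq_bigr => j nj do rewrite divdiff_is_linear 1?eq_sym //.
by rewrite big_split /= -scaler_sumr scalerDr scalerDr addrACA !scalerA mulrC.
Qed.

HB.instance Definition _ c i :=
  GRing.isLinear.Build K P P _ (dunkl_op c i) (dunkl_op_is_linear c i).

Lemma dunkl_opD c i : {morph dunkl_op c i : f g / f + g}.
Proof. exact: linearD. Qed.

Lemma dunkl_opB c i : {morph dunkl_op c i : f g / f - g}.
Proof. exact: linearB. Qed.

Lemma dunkl_opZ c i (a : K) : {morph dunkl_op c i : f / a *: f}.
Proof. exact: linearZ. Qed.

Lemma dunkl_op0 c i : dunkl_op c i 0 = 0.
Proof. exact: linear0. Qed.

Lemma dunkl_op_sum c i (J : Type) (r : seq J) (Q : pred J) (F : J -> P) :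
  dunkl_op c i (\sum_(j <- r | Q j) F j) =
    \sum_(j <- r | Q j) dunkl_op c i (F j).
Proof. exact: linear_sum. Qed.

Lemma dunkl_opJ c s i f : msym s (dunkl_op c i f) = dunkl_op c (s i) (msym s f).
Proof.
rewrite !dunkl_opE msymD msymZ mderivJ (raddf_sum (msym s)) /=;
  congr (_ + _ *: _).
rewrite [RHS](reindex_inj (@perm_inj _ s)) /=.
apply: eq_big => j; first by rewrite (inj_eq perm_inj).
by move=> nj; rewrite divdiffJ // eq_sym.
Qed.

Lemma dunkl_op_sym c i f : f \is symmetric -> dunkl_op c i f = f^`M(i).
Proof.
move=> /issymP fs; rewrite dunkl_opE big1 ?scaler0 ?addr0 // => j nj.
by rewrite divdiff_sym // eq_sym.
Qed.

Lemma dunkl_opM_sym c i f g : g \is symmetric ->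
  dunkl_op c i (f * g) = dunkl_op c i f * g + f * g^`M(i).
Proof.
move=> /issymP gs; rewrite !dunkl_opE mderivM mulrDl -addrA -[RHS]addrA.
congr (_ + _); rewrite addrC; congr (_ + _).
rewrite -scalerAl mulr_suml; congr (_ *: _); apply: eq_bigr => j nj.
rewrite eq_sym in nj.
by rewrite divdiffMl // gs (divdiff_sym _ (gs _)) // mulr0 addr0.
Qed.

Lemma dunkl_op1 c i : dunkl_op c i 1 = 0.
Proof. by rewrite dunkl_op_sym ?rpred1 // mderivC. Qed.

(* The commutator [D_i, x_k]. *)
Definition dunkl_bracket c i k f : P :=
  if i == k then f - c *: \sum_(j < n | j != i) msym (tperm i j) f
  else c *: msym (tperm i k) f.

Lemma dunkl_opX c i k f :
  dunkl_op c i ('X_k * f) = 'X_k * dunkl_op c i f + dunkl_bracket c i k f.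
Proof.
rewrite !dunkl_opE mderivM mderivX1.
under eq_bigr => j nj do rewrite divdiffMl 1?eq_sym // divdiffX 1?eq_sym //.
rewrite big_split /= -mulr_sumr scalerDr scalerAr mulrDr.
set A := 'X_k * _; set B := 'X_k * _.
have -> : forall x y : P, x + A + (y + B) = A + B + (x + y).
  by move=> x y; ring.
congr (_ + _); rewrite /dunkl_bracket; case: (altP (i =P k)) => [<-|nik].
  rewrite eqxx mpolyC1 mul1r; congr (_ + _); rewrite -scalerN -sumrN.
  congr (_ *: _); apply: eq_bigr => j nj.
  by rewrite (negbTE nj) sub0r mpolyCN mpolyC1 mulN1r.
rewrite [k == i]eq_sym (negbTE nik) mpolyC0 mul0r add0r; congr (_ *: _).
rewrite (bigD1 k) 1?eq_sym //= eqxx subr0 mpolyC1 mul1r big1 ?addr0 //.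
move=> j /andP[_ njk].
by rewrite (negbTE njk) subrr mpolyC0 mul0r.
Qed.

Lemma dunkl_bracketC c i k f : dunkl_bracket c i k f = dunkl_bracket c k i f.
Proof. by rewrite /dunkl_bracket eq_sym; case: eqP => [->//|_];
  rewrite tpermC. Qed.

Lemma dunkl_op_tperm c i j k f :
  dunkl_op c k (msym (tperm i j) f) =
    msym (tperm i j) (dunkl_op c (tperm i j k) f).
Proof. by rewrite dunkl_opJ tpermK. Qed.

(** By the Jacobi identity this says that [[D_i, D_j]] commutes with [x_k]. Since [[D_i, D_j]] also
    kills 1, it vanishes, which is [dunkl_op_commut]. *)
Lemma dunkl_bracket_commut c i j k f : i != j ->
  dunkl_bracket c i k (dunkl_op c j f) + dunkl_op c i (dunkl_bracket c j k f) =
  dunkl_bracket c j k (dunkl_op c i f) + dunkl_op c j (dunkl_bracket c i k f).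
Proof.
have main i' j' : i' != j' ->
  dunkl_bracket c i' i' (dunkl_op c j' f) + dunkl_op c i' (dunkl_bracket c j'
    i' f) =
  dunkl_bracket c j' i' (dunkl_op c i' f) + dunkl_op c j' (dunkl_bracket c i'
    i' f).
  move=> nij; have nji : j' != i' by rewrite eq_sym.
  rewrite /dunkl_bracket eqxx (negbTE nji) dunkl_opB !dunkl_opZ.
  have e : dunkl_op c j' (\sum_(l < n | (l != i') && (l != j')) msym (tperm i'
    l) f)
      = \sum_(l < n | (l != i') && (l != j')) msym (tperm i' l) (dunkl_op c j'
        f).
    rewrite dunkl_op_sum; apply: eq_bigr => l /andP[nl1 nl2].
    by rewrite dunkl_op_tperm tpermD // eq_sym.
  rewrite (bigD1 j') //= [in RHS](bigD1 j') //= -e dunkl_opD !(tpermC j' i').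
  rewrite (dunkl_op_tperm c i' j' i') (dunkl_op_tperm c i' j' j') tpermL tpermR.
  have id (a x y z : P) :
    a - c *: (x + z) + c *: x = c *: y + (a - c *: (y + z)).
    by rewrite -!mul_mpolyC; ring.
  exact: id.
move=> nij; case: (eqVneq i k) => [<-|nik]; first exact: main.
case: (eqVneq j k) => [<-|njk]; first by apply/esym/main; rewrite eq_sym.
rewrite /dunkl_bracket (negbTE nik) (negbTE njk) !dunkl_opZ.
rewrite (dunkl_op_tperm c j k i) (dunkl_op_tperm c i k j).
have -> : tperm j k i = i by rewrite tpermD // eq_sym.
have -> : tperm i k j = j by rewrite tpermD // eq_sym.
exact: addrC.
Qed.

Lemma dunkl_op_commut c i j f : dunkl_op c i (dunkl_op c j f) =
  dunkl_op c j (dunkl_op c i f).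
Proof.
case: (eqVneq i j) => [->//|nij].
elim/mpoly_ind_X: f => [f g Hf Hg|a f Hf||k f Hf].
- by rewrite !dunkl_opD Hf Hg.
- by rewrite !dunkl_opZ Hf.
- by rewrite !dunkl_op1 !dunkl_op0.
- rewrite !dunkl_opX !dunkl_opD !dunkl_opX Hf -!addrA; congr (_ + _).
  exact: dunkl_bracket_commut.
Qed.

End Dunkl.

(** * The Dunkl form *)

Lemma mpoly_ind_mon (K : numFieldType) (n : nat) (Q : {mpoly K[n]} -> Prop) :
  (forall f g, Q f -> Q g -> Q (f + g)) -> (forall a f, Q f -> Q (a *: f)) ->
  (forall u, Q 'X_[u]) -> forall f, Q f.
Proof.
move=> QD QZ QX f; rewrite [f]mpolyE.
have Q0 : Q 0 by rewrite -(scale0r 'X_[0]); apply: QZ.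
by apply: (big_ind Q) => // u _; apply: QZ.
Qed.

(** A common index set for polynomials with different supports, from which linearity in [f]
    follows. *)
Lemma msupp_sumE (K : numFieldType) (n : nat) (V : lmodType K)
    (phi : 'X_{1..n} -> V) (f : {mpoly K[n]}) k : (msize f <= k)%N ->
  \sum_(u <- msupp f) f@_u *: phi u = \sum_(u : 'X_{1..n < k}) f@_u *: phi u.
Proof.
move=> le_fk; set J : subFinType _ := 'X_{1..n < k}.
rewrite (big_mksub J) ?msupp_uniq //=; first last.
  by move=> x /msize_mdeg_lt /leq_trans; apply.
by rewrite big_rmcond //= => j /memN_msupp_eq0 ->; rewrite scale0r.
Qed.

Lemma msupp_sum_is_linear (K : numFieldType) (n : nat) (V : lmodType K)
    (phi : 'X_{1..n} -> V) :
  linear (fun f : {mpoly K[n]} => \sum_(u <- msupp f) f@_u *: phi u).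
Proof.
move=> a f g; pose k := maxn (msize (a *: f + g)) (maxn (msize f) (msize g)).
rewrite !(@msupp_sumE _ _ _ _ _ k) ?leq_max ?leqnn ?orbT //.
rewrite scaler_sumr -big_split; apply: eq_bigr => u _ /=.
by rewrite mcoeffD mcoeffZ scalerDl scalerA.
Qed.

HB.lock Definition dunkl_mon (K : numFieldType) (n : nat) (c : K)
    (u : 'X_{1..n}) (g : {mpoly K[n]}) : {mpoly K[n]} :=
  foldr (fun i h => iter (u i) (dunkl_op c i) h) g (enum 'I_n).

HB.lock Definition dunkl_ev (K : numFieldType) (n : nat) (c : K)
    (f g : {mpoly K[n]}) : {mpoly K[n]} :=
  \sum_(u <- msupp f) f@_u *: dunkl_mon c u g.

HB.lock Definition dunkl_pair (K : numFieldType) (n : nat) (c : K)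
    (f g : {mpoly K[n]}) : K :=
  (dunkl_ev c f g).@[fun=> 0].

Section DunklPairing.
Variables (K : numFieldType) (n : nat) (c : K).
Local Notation P := {mpoly K[n]}.
Implicit Types (f g h : P) (a : K) (i j k : 'I_n) (s : 'S_n) (u : 'X_{1..n}).

Lemma dunkl_op_iter i j (d : nat) h :
  dunkl_op c i (iter d (dunkl_op c j) h) =
    iter d (dunkl_op c j) (dunkl_op c i h).
Proof. by elim: d => //= d IHd; rewrite dunkl_op_commut IHd. Qed.

Lemma dunkl_mon0 g : dunkl_mon c 0%MM g = g.
Proof. by rewrite dunkl_mon.unlock; elim: (enum _) => //= i r ->;
  rewrite mnm0E. Qed.

(** The additional [D_i] sits in the middle of the ordered product, at the place of [i] in
    [enum 'I_n]; commutativity moves it to the outside. *)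
Lemma dunkl_monS i u g :
  dunkl_mon c (U_(i) + u)%MM g = dunkl_op c i (dunkl_mon c u g).
Proof.
rewrite dunkl_mon.unlock.
pose F (v : 'X_{1..n}) (r : seq 'I_n) :=
  foldr (fun i h => iter (v i) (dunkl_op c i) h) g r : P.
have H r : uniq r ->
    F (U_(i) + u)%MM r = if i \in r then dunkl_op c i (F u r) else F u r.
  elim: r => //= j r IHr /andP[njr /IHr {}IHr]; rewrite IHr inE mnmDE mnm1E.
  case: (eqVneq i j) => [->|nij] /=; first by rewrite (negbTE njr).
  by case: ifP => // _; rewrite dunkl_op_iter.
by have := H _ (enum_uniq 'I_n); rewrite mem_enum.
Qed.

Lemma dunkl_mon_is_linear u : linear (dunkl_mon c u).
Proof.
rewrite dunkl_mon.unlock => a f g; elim: (enum _) => //= i r ->.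
by elim: (u i) => //= k ->; rewrite dunkl_opD dunkl_opZ.
Qed.

Lemma dunkl_evDl f g h : dunkl_ev c (f + g) h = dunkl_ev c f h + dunkl_ev c g h.
Proof.
rewrite dunkl_ev.unlock.
have := msupp_sum_is_linear (dunkl_mon c ^~ h) 1 f g.
by rewrite !scale1r.
Qed.

Lemma dunkl_evZl a f h : dunkl_ev c (a *: f) h = a *: dunkl_ev c f h.
Proof.
rewrite dunkl_ev.unlock.
have := msupp_sum_is_linear (dunkl_mon c ^~ h) a f 0.
by rewrite msupp0 big_nil !addr0.
Qed.

Lemma dunkl_ev_is_linear f : linear (dunkl_ev c f).
Proof.
rewrite dunkl_ev.unlock => a g h; rewrite scaler_sumr -big_split.
apply: eq_bigr => u _ /=; rewrite dunkl_mon_is_linear scalerDr !scalerA.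
by rewrite mulrC.
Qed.

HB.instance Definition _ f :=
  GRing.isLinear.Build K P P _ (dunkl_ev c f) (dunkl_ev_is_linear f).

Lemma dunkl_evDr f g h : dunkl_ev c f (g + h) = dunkl_ev c f g + dunkl_ev c f h.
Proof. exact: linearD. Qed.

Lemma dunkl_evZr a f h : dunkl_ev c f (a *: h) = a *: dunkl_ev c f h.
Proof. exact: linearZ. Qed.

Lemma dunkl_evX u h : dunkl_ev c 'X_[u] h = dunkl_mon c u h.
Proof. by rewrite dunkl_ev.unlock msuppX big_seq1 mcoeffX eqxx scale1r. Qed.

Lemma dunkl_ev1 h : dunkl_ev c 1 h = h.
Proof. by rewrite -mpolyX0 dunkl_evX dunkl_mon0. Qed.

Lemma dunkl_evXM k f h : dunkl_ev c ('X_k * f) h =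
  dunkl_op c k (dunkl_ev c f h).
Proof.
elim/mpoly_ind_mon: f => [f g Hf Hg|a f Hf|u].
- by rewrite mulrDr !dunkl_evDl Hf Hg dunkl_opD.
- by rewrite -scalerAr !dunkl_evZl Hf dunkl_opZ.
- by rewrite -mpolyXD !dunkl_evX dunkl_monS.
Qed.

Lemma dunkl_evXU k h : dunkl_ev c 'X_k h = dunkl_op c k h.
Proof. by rewrite -['X_k]mulr1 dunkl_evXM dunkl_ev1. Qed.

Lemma dunkl_evM f g h : dunkl_ev c (f * g) h = dunkl_ev c f (dunkl_ev c g h).
Proof.
elim/mpoly_ind_X: f => [f f' Hf Hf'|a f Hf||k f Hf].
- by rewrite mulrDl !dunkl_evDl Hf Hf'.
- by rewrite -scalerAl !dunkl_evZl Hf.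
- by rewrite mul1r dunkl_ev1.
- by rewrite -mulrA !dunkl_evXM Hf.
Qed.

Lemma dunkl_ev_op k f h : dunkl_ev c f (dunkl_op c k h) =
  dunkl_op c k (dunkl_ev c f h).
Proof. by rewrite -dunkl_evXU -dunkl_evM mulrC dunkl_evXM. Qed.

Lemma dunkl_ev_msym s f h : msym s (dunkl_ev c f h) =
  dunkl_ev c (msym s f) (msym s h).
Proof.
elim/mpoly_ind_X: f => [f f' Hf Hf'|a f Hf||k f Hf].
- by rewrite msymD !dunkl_evDl msymD Hf Hf'.
- by rewrite msymZ !dunkl_evZl msymZ Hf.
- by rewrite msym1 !dunkl_ev1.
- by rewrite msymM msymXU !dunkl_evXM dunkl_opJ Hf.
Qed.

Lemma meval0_msym s f : (msym s f).@[fun=> 0] = f.@[fun=> 0].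
Proof.
elim/mpoly_ind_X: f => [f f' Hf Hf'|a f Hf||k f Hf].
- by rewrite msymD !mevalD Hf Hf'.
- by rewrite msymZ !mevalZ Hf.
- by rewrite msym1.
- by rewrite msymM msymXU !mevalM !mevalXU !mul0r.
Qed.

Lemma dunkl_pairE f g : dunkl_pair c f g = (dunkl_ev c f g).@[fun=> 0].
Proof. by rewrite dunkl_pair.unlock. Qed.

Lemma dunkl_pairDl f g h : dunkl_pair c (f + g) h =
  dunkl_pair c f h + dunkl_pair c g h.
Proof. by rewrite !dunkl_pairE dunkl_evDl mevalD. Qed.

Lemma dunkl_pairZl a f h : dunkl_pair c (a *: f) h = a * dunkl_pair c f h.
Proof. by rewrite !dunkl_pairE dunkl_evZl mevalZ. Qed.

Lemma dunkl_pairDr f g h : dunkl_pair c f (g + h) =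
  dunkl_pair c f g + dunkl_pair c f h.
Proof. by rewrite !dunkl_pairE dunkl_evDr mevalD. Qed.

Lemma dunkl_pairZr a f h : dunkl_pair c f (a *: h) = a * dunkl_pair c f h.
Proof. by rewrite !dunkl_pairE dunkl_evZr mevalZ. Qed.

Lemma dunkl_pair_msym s f g : dunkl_pair c (msym s f) (msym s g) =
  dunkl_pair c f g.
Proof. by rewrite !dunkl_pairE -dunkl_ev_msym meval0_msym. Qed.

Lemma dunkl_pair_tperm i j f g :
  dunkl_pair c f (msym (tperm i j) g) = dunkl_pair c (msym (tperm i j) f) g.
Proof.
rewrite -[LHS](dunkl_pair_msym (tperm i j)); congr (dunkl_pair c _ _).
by rewrite -msymMm tperm2 msym1m.
Qed.

Lemma dunkl_pairXl k f g : dunkl_pair c ('X_k * f) g =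
  dunkl_pair c f (dunkl_op c k g).
Proof. by rewrite !dunkl_pairE dunkl_evXM dunkl_ev_op. Qed.

Lemma dunkl_pair_suml (J : Type) (r : seq J) (Q : pred J) (F : J -> P) g :
  dunkl_pair c (\sum_(j <- r | Q j) F j) g =
    \sum_(j <- r | Q j) dunkl_pair c (F j) g.
Proof.
apply: (big_morph (dunkl_pair c ^~ g)) => [f h|]; first exact: dunkl_pairDl.
by rewrite -(scale0r 0) dunkl_pairZl mul0r.
Qed.

Lemma dunkl_pair_sumr (J : Type) (r : seq J) (Q : pred J) (F : J -> P) f :
  dunkl_pair c f (\sum_(j <- r | Q j) F j) =
    \sum_(j <- r | Q j) dunkl_pair c f (F j).
Proof.
apply: (big_morph (dunkl_pair c f)) => [g h|]; first exact: dunkl_pairDr.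
by rewrite -(scale0r 0) dunkl_pairZr mul0r.
Qed.

(** [[D_i, x_k]] is a combination of the identity and transpositions, all self-adjoint for an
    invariant form. *)
Lemma dunkl_pair_bracket i k f g :
  dunkl_pair c f (dunkl_bracket c i k g) =
    dunkl_pair c (dunkl_bracket c i k f) g.
Proof.
rewrite /dunkl_bracket; case: ifP => _; last first.
  by rewrite dunkl_pairZl dunkl_pairZr dunkl_pair_tperm.
rewrite -!scaleN1r dunkl_pairDl dunkl_pairDr !dunkl_pairZl !dunkl_pairZr.
rewrite dunkl_pair_suml dunkl_pair_sumr; congr (_ + _ * (_ * _)).
by apply: eq_bigr => j _; rewrite dunkl_pair_tperm.
Qed.

(** The definition makes [D_k] adjoint to [x_k] in the first argument only. For the second argument,
    passing from [f] to [x_j f] produces the commutators [[D_j, x_k]] and [[D_k, x_j]], which are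
    equal and self-adjoint. *)
Lemma dunkl_pairXr k f g : dunkl_pair c f ('X_k * g) =
  dunkl_pair c (dunkl_op c k f) g.
Proof.
elim/mpoly_ind_X: f g => [f f' Hf Hf'|a f Hf||j f Hf] g.
- by rewrite dunkl_pairDl dunkl_opD dunkl_pairDl Hf Hf'.
- by rewrite dunkl_pairZl dunkl_opZ dunkl_pairZl Hf.
- rewrite dunkl_op1 -(scale0r 0) dunkl_pairZl mul0r dunkl_pairE dunkl_ev1.
  by rewrite mevalM mevalXU mul0r.
- rewrite dunkl_pairXl !dunkl_opX dunkl_pairDl dunkl_pairDr Hf dunkl_pairXl.
  by rewrite dunkl_pair_bracket dunkl_bracketC.
Qed.

Lemma dunkl_pairC f g : dunkl_pair c f g = dunkl_pair c g f.
Proof.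
elim/mpoly_ind_X: f g => [f f' Hf Hf'|a f Hf||j f Hf] g.
- by rewrite dunkl_pairDl dunkl_pairDr Hf Hf'.
- by rewrite dunkl_pairZl dunkl_pairZr Hf.
- rewrite [LHS]dunkl_pairE dunkl_ev1.
  elim/mpoly_ind_X: g => [g g' Hg Hg'|a g Hg||j g Hg].
  + by rewrite mevalD dunkl_pairDl Hg Hg'.
  + by rewrite mevalZ dunkl_pairZl Hg.
  + by rewrite dunkl_pairE dunkl_ev1.
  + rewrite dunkl_pairXl dunkl_op1 -(scale0r 0) dunkl_pairZr mul0r.
    by rewrite mevalM mevalXU mul0r.
- by rewrite dunkl_pairXl Hf dunkl_pairXr.
Qed.

End DunklPairing.

Lemma mnm_split (n d : nat) (u : 'X_{1..n}) : mdeg u = d.+1 ->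
  exists k v, u = (U_(k) + v)%MM /\ mdeg v = d.
Proof.
move=> ud; have [k uk] : exists k, u k != 0%N.
  apply/existsP; apply: contraLR (isT : d.+1 != 0%N);
    rewrite negb_exists => /forallP u0.
  rewrite -ud mdeg_eq0 negbK; apply/eqP/mnmP => k; rewrite mnm0E; apply/eqP.
  by have := u0 k; rewrite negbK.
have uE : u = (U_(k) + (u - U_(k)))%MM by rewrite addmC submK // lep1mP.
exists k, (u - U_(k))%MM; split=> //.
by move: ud; rewrite [in mdeg u]uE mdegD mdeg1 => -[].
Qed.

(** * The Dunkl Laplacian *)

HB.lock Definition dunkl_lap (K : numFieldType) (n : nat) (c : K)
    (f : {mpoly K[n]}) : {mpoly K[n]} :=
  \sum_(i < n) dunkl_op c i (dunkl_op c i f).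

Section DunklLaplacian.
Variables (K : numFieldType) (n : nat) (c : K).
Local Notation P := {mpoly K[n]}.
Implicit Types (f g h : P) (a : K) (i j k : 'I_n) (s : 'S_n) (u : 'X_{1..n}).

Lemma dunkl_lapE f : dunkl_lap c f = \sum_(i < n) dunkl_op c i (dunkl_op c i f).
Proof. by rewrite dunkl_lap.unlock. Qed.

Lemma dunkl_lap_is_linear : linear (dunkl_lap c : P -> P).
Proof.
move=> a f g; rewrite !dunkl_lapE scaler_sumr -big_split;
  apply: eq_bigr => i _ /=.
by rewrite !(dunkl_opD, dunkl_opZ).
Qed.

HB.instance Definition _ :=
  GRing.isLinear.Build K P P _ (dunkl_lap c) dunkl_lap_is_linear.

Lemma dunkl_lap_op k f : dunkl_lap c (dunkl_op c k f) =
  dunkl_op c k (dunkl_lap c f).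
Proof.
rewrite !dunkl_lapE dunkl_op_sum; apply: eq_bigr => i _.
by rewrite (dunkl_op_commut c k i) (dunkl_op_commut c k i).
Qed.

Lemma dunkl_lap_msym s f : msym s (dunkl_lap c f) = dunkl_lap c (msym s f).
Proof.
rewrite !dunkl_lapE (raddf_sum (msym s)) [RHS](reindex_inj (@perm_inj _ s)) /=.
by apply: eq_bigr => i _; rewrite !dunkl_opJ.
Qed.

(** In the sum over i of [D_i [D_i, x_k] + [D_i, x_k] D_i], the reflections from i = k cancel those
    from the other i, because [D_i s_ik = s_ik D_k]. *)
Lemma dunkl_lapX k f :
  dunkl_lap c ('X_k * f) = 'X_k * dunkl_lap c f + 2%:R *: dunkl_op c k f.
Proof.
rewrite !dunkl_lapE mulr_sumr.
under eq_bigr => i _ do rewrite !dunkl_opX dunkl_opD dunkl_opX -addrA.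
rewrite big_split; congr (_ + _) => /=.
rewrite (bigD1 k) //= /dunkl_bracket eqxx dunkl_opB dunkl_opZ dunkl_op_sum.
under eq_bigr => i nik.
  rewrite (negbTE nik) dunkl_opZ -scalerDr.
  have -> : msym (tperm i k) (dunkl_op c i f) =
    dunkl_op c k (msym (tperm i k) f).
    by rewrite dunkl_opJ tpermL.
  rewrite (tpermC i k) addrC; over.
rewrite -scaler_sumr big_split /=.
have -> : \sum_(i < n | i != k) dunkl_op c i (msym (tperm k i) f) =
          \sum_(i < n | i != k) msym (tperm k i) (dunkl_op c k f).
  by apply: eq_bigr => i _; rewrite dunkl_opJ tpermL.
have id (x y z : P) : x - c *: y + (x - c *: z) + c *: (y + z) = 2%:R *: x.
  by rewrite scaler_nat -!mul_mpolyC; ring.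
exact: id.
Qed.

End DunklLaplacian.

(** * Iterated commutators with a multiple of the Laplacian *)

Definition op_bracket (V : zmodType) (G T : V ->
  V) (g : V) : V := G (T g) - T (G g).

Section IteratedBracket.
Variables (K : numFieldType) (n : nat) (c a : K).
Local Notation P := {mpoly K[n]}.
Variable G : P -> P.
Hypothesis G_linear : linear G.
Hypothesis G_op : forall k f, G (dunkl_op c k f) = dunkl_op c k (G f).
Hypothesis G_X : forall k f, G ('X_k * f) = 'X_k * G f + a *: dunkl_op c k f.
Implicit Types (f g b : P) (k : 'I_n) (T : P -> P) (u : 'X_{1..n}).
Local Notation ad := (op_bracket G).

Let G0 : G 0 = 0.
Proof. by have := G_linear (-1) 0 0; rewrite scaler0 addr0 scaleN1r addNr. Qed.

Let GD f g : G (f + g) = G f + G g.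
Proof. by have := G_linear 1 f g; rewrite !scale1r. Qed.

Let GZ x f : G (x *: f) = x *: G f.
Proof. by have := G_linear x f 0; rewrite G0 !addr0. Qed.

Lemma iter_bracket_lin e x T T' g :
  iter e ad (fun h => x *: T h + T' h) g = x *: iter e ad T g + iter e ad T' g.
Proof.
elim: e g => //= e IHe g; rewrite /op_bracket !IHe G_linear scalerBr opprD.
by rewrite addrACA.
Qed.

(** Leibniz rule for the derivation [ad G]: it sends [x_k] to [a D_k] and [D_k] to 0, so two terms
    of the binomial expansion survive. For e = 0 the truncated [e.-1] comes with coefficient 0. *)
Lemma iter_bracket_X e k T g :
  iter e ad (fun h => 'X_k * T h) g =
  'X_k * iter e ad T g + (e%:R * a) *: dunkl_op c k (iter e.-1 ad T g).
Proof.
elim: e g => [|e IHe] g; first by rewrite mul0r scale0r addr0.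
rewrite iterS [LHS]/op_bracket !IHe GD GZ G_op G_X.
rewrite [in RHS]iterS [ad (iter e ad T)]/op_bracket /=.
have -> : (e%:R * a) *: dunkl_op c k (G (iter e.-1 ad T g)) =
  (e%:R * a) *: dunkl_op c k (iter e ad T g) +
  (e%:R * a) *: dunkl_op c k (iter e.-1 ad T (G g)).
  case: e {IHe} => [|e] /=; first by rewrite mul0r !scale0r addr0.
  by rewrite {2}/op_bracket dunkl_opB scalerBr subrK.
rewrite -natr1 mulrDl mul1r.
have id (p x y z t w : P) (b : K) : p * x + a *: y + (b *: y + z) - (p * t + z)
  =
   p * (x - t) + (b + a) *: y.
  by rewrite -!mul_mpolyC mpolyCD; ring.
exact: id.
Qed.

Lemma bracket_dunkl_mon u g : G (dunkl_mon c u g) = dunkl_mon c u (G g).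
Proof.
rewrite dunkl_mon.unlock; elim: (enum _) => //= i r <-.
elim: (u i) (foldr _ _ _) => //= d IHd h; by rewrite G_op IHd.
Qed.

Lemma iter_bracket_mon u g :
  iter (mdeg u) ad (fun h => 'X_[u] * h) g =
  (a ^+ mdeg u * (mdeg u)`!%:R) *: dunkl_mon c u g.
Proof.
move: {-1}(mdeg u) (erefl (mdeg u)) => d; elim: d u g => [|d IHd] u g ud.
  move/eqP: ud; rewrite mdeg_eq0 => /eqP -> /=.
  by rewrite expr0 mul1r scale1r dunkl_mon0 mpolyX0 mul1r.
have [k [v [uE vd]]] := mnm_split ud.
have -> : iter d.+1 ad (fun h => 'X_[u] * h) g =
          iter d.+1 ad (fun h => 'X_k * ('X_[v] * h)) g.
  congr (iter _ _ _ g); apply: boolp.funext => h.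
  by rewrite uE mpolyXD mulrA.
(* After d brackets [X_[v]] has become a multiple of [D^v], which commutes with [G]; one more
   bracket kills the first term. *)
rewrite iter_bracket_X /= {1}/op_bracket !IHd // GZ bracket_dunkl_mon subrr
  mulr0 add0r.
rewrite dunkl_opZ scalerA -dunkl_monS -uE; congr (_ *: _).
by rewrite exprS factS natrM; ring.
Qed.

(* Dunkl operators commute with [G], while each of the [d] factors [x_k] of a
   monomial can be hit only once, so that [ad G ^ d] replaces every [x_k] by
   [a D_k]. *)
Lemma iter_bracket_homog d b g : b \is d.-homog ->
  iter d ad (fun h => b * h) g = (a ^+ d * d`!%:R) *: dunkl_ev c b g.
Proof.
move=> /dhomogP bd; rewrite dunkl_ev.unlock [in LHS](mpolyE b).
have : {in msupp b, forall u, mdeg u = d} by [].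
elim: (msupp b) g => [|u r IHr] g rd.
  rewrite [X in _ *: X]big_nil scaler0 big_nil.
  under boolp.eq_fun => h do rewrite mul0r.
  elim: d {bd rd} g => //= d IHd g; rewrite /op_bracket !IHd subr0.
  exact: G0.
rewrite [X in _ *: X]big_cons scalerDr -IHr => [|v vr]; last by apply: rd;
  rewrite inE vr orbT.
under boolp.eq_fun => h do rewrite big_cons mulrDl -scalerAl.
rewrite iter_bracket_lin; congr (_ + _).
have <- := rd u (mem_head _ _).
by rewrite iter_bracket_mon !scalerA mulrC.
Qed.

End IteratedBracket.

(** A relation replaces a map here, so that the result covers both g -> W g on symmetric polynomials
    and the multivalued [psum_rel]. *)
Lemma iter_bracket_transfer (V V' : zmodType) (Rel : V -> V' -> Prop)
    (G T : V -> V) (G' T' : V' -> V') :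
  (forall f f' g g', Rel f f' -> Rel g g' -> Rel (f - g) (f' - g')) ->
  (forall f f', Rel f f' -> Rel (G f) (G' f')) ->
  (forall f f', Rel f f' -> Rel (T f) (T' f')) ->
  forall d f f', Rel f f' ->
  Rel (iter d (op_bracket G) T f) (iter d (op_bracket G') T' f').
Proof.
move=> RB RG RT; elim=> [|d IHd] f f' ff' /=; first exact: RT.
by apply: RB; [apply/RG/IHd | apply/IHd/RG].
Qed.

(** The operator b(D) is a multiple of the d-fold commutator of H with multiplication by b. A
    correspondence respecting these two therefore respects b(D), and rescaling H by x costs a factor
    x^d. It is applied with x = 1 for W and with x = m/n for the duality. *)
Lemma dunkl_ev_transfer (K : numFieldType) (n m d : nat) (c c' x : K)
    (Rel : {mpoly K[n]} -> {mpoly K[m]} -> Prop) b b' f f' :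
  (forall f f' g g', Rel f f' -> Rel g g' -> Rel (f - g) (f' - g')) ->
  (forall f f', Rel f f' -> Rel (dunkl_lap c f) (x *: dunkl_lap c' f')) ->
  (forall f f', Rel f f' -> Rel (b * f) (b' * f')) ->
  b \is d.-homog -> b' \is d.-homog -> Rel f f' ->
  Rel ((2%:R ^+ d * d`!%:R) *: dunkl_ev c b f)
      (((x * 2%:R) ^+ d * d`!%:R) *: dunkl_ev c' b' f').
Proof.
move=> RB RG RM bd b'd ff'.
have <- := @iter_bracket_homog _ _ c 2%:R (dunkl_lap c) (@dunkl_lap_is_linear _
  _ c)
  (@dunkl_lap_op _ _ c) (@dunkl_lapX _ _ c) d b f bd.
have <- := @iter_bracket_homog _ _ c' (x * 2%:R) (fun h =>
  x *: dunkl_lap c' h) _ _ _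
  d b' f' b'd.
- exact: iter_bracket_transfer.
- by move=> a g h; rewrite dunkl_lap_is_linear scalerDr !scalerA mulrC.
- by move=> k g; rewrite dunkl_lap_op dunkl_opZ.
- by move=> k g; rewrite dunkl_lapX scalerDr scalerAr scalerA.
Qed.

(** * Homogeneous components *)

Section Homogeneity.
Variables (K : numFieldType) (n : nat) (c : K).
Local Notation P := {mpoly K[n]}.
Implicit Types (f g h p q : P) (a : K) (i j k : 'I_n) (s : 'S_n) (u :
  'X_{1..n}).

Lemma dhomog_lin (L : P -> P) d e : linear L ->
  (forall u, mdeg u = d -> L 'X_[u] \is e.-homog) ->
  forall f, f \is d.-homog -> L f \is e.-homog.
Proof.
move=> linL LX f /dhomogP fd.
rewrite [f]mpolyE; elim: (msupp f) fd => [|u r IHr] rd.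
  rewrite big_nil; have := linL (-1) 0 0.
  by rewrite scaler0 addr0 scaleN1r addNr => ->; apply: rpred0.
rewrite big_cons linL; apply: rpredD; last first.
  by apply: IHr => v vr; apply: rd; rewrite inE vr orbT.
by apply/rpredZ/LX/rd; rewrite inE eqxx.
Qed.

Lemma dhomog_mpolyX d u : mdeg u = d -> ('X_[u] : P) \is d.-homog.
Proof. by move=> ud; rewrite dhomogX; apply/eqP. Qed.

Lemma dhomogXU k : ('X_k : P) \is 1.-homog.
Proof. exact/dhomog_mpolyX/mdeg1. Qed.

Lemma dhomog_msym d s f : f \is d.-homog -> msym s f \is d.-homog.
Proof.
apply: dhomog_lin; first exact: linearP.
by move=> u ud; rewrite msymX; apply: dhomog_mpolyX; rewrite mdeg_mperm.
Qed.

Lemma dhomog_bracket d i k f : f \is d.-homog ->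
  dunkl_bracket c i k f \is d.-homog.
Proof.
move=> fd; rewrite /dunkl_bracket; case: ifP => _;
  last by rewrite rpredZ // dhomog_msym.
apply: rpredB => //; apply: rpredZ; apply: rpred_sum => j _; exact: dhomog_msym.
Qed.

Lemma dhomog0_const f : f \is 0.-homog -> f = f@_0 *: 1.
Proof.
move=> /dhomogP f0; apply/mpolyP => u; rewrite mcoeffZ mcoeff1.
case: eqP => [->|u0]; rewrite ?mulr1 ?mulr0 //.
apply: memN_msupp_eq0; apply/negP => /f0 /eqP; rewrite mdeg_eq0 => /eqP;
  exact: u0.
Qed.

Lemma dunkl_op_homog0 i f : f \is 0.-homog -> dunkl_op c i f = 0.
Proof. by move=> /dhomog0_const ->; rewrite dunkl_opZ dunkl_op1 scaler0. Qed.

Lemma dhomog_dunkl_op d i f : f \is d.+1.-homog -> dunkl_op c i f \is d.-homog.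
Proof.
elim: d f => [|d IHd]; apply: dhomog_lin; try exact: linearP.
  move=> u /mnm_split[k [v [-> /eqP]]]; rewrite mdeg_eq0 => /eqP ->.
  rewrite addm0 -['X_k]mulr1 dunkl_opX dunkl_op1 mulr0 add0r.
  by apply: dhomog_bracket; apply: dhomog1.
move=> u /mnm_split[k [v [-> vd]]]; rewrite mpolyXD dunkl_opX.
have Xv : ('X_[v] : P) \is d.+1.-homog by exact: dhomog_mpolyX.
apply: rpredD; last exact: dhomog_bracket.
by rewrite -[d.+1]add1n; apply: dhomogM; [exact: dhomogXU | exact: IHd].
Qed.

Lemma meval0_homog d f : f \is d.+1.-homog -> f.@[fun=> 0] = 0.
Proof.
move=> /dhomogP fd; rewrite [f]mpolyE raddf_sum /= big_seq big1 // => u /fd.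
by move=> /mnm_split[k [v [-> _]]];
  rewrite mevalZ mpolyXD mevalM mevalXU mul0r mulr0.
Qed.

Lemma dunkl_pair_homog d e f g : d != e -> f \is d.-homog -> g \is e.-homog ->
  dunkl_pair c f g = 0.
Proof.
elim: d e f g => [|d IHd] e f g.
  case: e => // e _ /dhomog0_const -> ge.
  by rewrite dunkl_pairZl dunkl_pairE dunkl_ev1 (meval0_homog ge) mulr0.
move=> de /dhomogP fd ge.
rewrite [f]mpolyE dunkl_pair_suml big_seq big1 // =>
  u /fd /mnm_split[k [v [-> vd]]].
rewrite dunkl_pairZl mpolyXD dunkl_pairXl.
case: e => [|e] in de ge *.
  by rewrite dunkl_op_homog0 // -(scale0r 0) dunkl_pairZr mul0r mulr0.
by rewrite (IHd e) ?mulr0 //; [exact: dhomog_mpolyX | exact: dhomog_dunkl_op].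
Qed.

Lemma pihomogM d e p q : q \is e.-homog ->
  pihomog mdeg d (p * q) = if (e <= d)%N then pihomog mdeg (d - e) p * q else 0.
Proof.
move=> qe; elim/mpoly_ind_mon: p => [f g Hf Hg|a f Hf|u].
- by rewrite mulrDl !pihomogD Hf Hg; case: ifP; rewrite ?mulrDl ?addr0.
- by rewrite -scalerAl !linearZ /= Hf; case: ifP; rewrite ?scalerAl ?scaler0.
have h : 'X_[u] * q \is (mdeg u + e).-homog by apply: dhomogM => //;
  apply: dhomog_mpolyX.
rewrite pihomogX; case: (eqVneq (mdeg u + e)%N d) => [de|de].
  by rewrite -de leq_addl addnK eqxx pihomog_dE.
rewrite (pihomog_ne0 de h); case: leqP => // ed.
by rewrite -(eqn_add2r e) subnK // (negbTE de) mul0r.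
Qed.

Lemma pihomogMM d p q :
  pihomog mdeg d (p * q) = \sum_(e < d.+1) pihomog mdeg (d - e) p * pihomog
    mdeg e q.
Proof.
have qE := pihomog_partitionE (leqnn (mmeasure mdeg q)).
set N := mmeasure mdeg q in qE; pose M := maxn N d.+1.
have {}qE : q = \sum_(e < M) pihomog mdeg e q.
  by apply: pihomog_partitionE; apply: leq_maxl.
rewrite [in LHS]qE mulr_sumr linear_sum /=.
rewrite (eq_bigr (fun e : 'I_M => if (e < d.+1)%N then
    pihomog mdeg (d - e) p * pihomog mdeg e q else 0)); last first.
  by move=> e _; rewrite (pihomogM _ _ (pihomogP _ _ _)).
rewrite -big_mkcond /= (big_ord_widen M (fun e =>
  pihomog mdeg (d - e) p * pihomog mdeg e q)) //.
exact: leq_maxr.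
Qed.

End Homogeneity.

(** * The ring generated by differences of variables *)

Section DifferenceRing.
Variables (K : numFieldType) (n : nat).
Local Notation P := {mpoly K[n]}.
Implicit Types (f g h p q : P) (a c : K) (i j k : 'I_n) (s : 'S_n) (u :
  'X_{1..n}).

Inductive diff_poly : set P :=
| diff_polyC a : diff_poly a%:MP
| diff_polyX i j : diff_poly ('X_i - 'X_j)
| diff_polyD f g of diff_poly f & diff_poly g : diff_poly (f + g)
| diff_polyM f g of diff_poly f & diff_poly g : diff_poly (f * g).

Lemma diff_polyZ a f : diff_poly f -> diff_poly (a *: f).
Proof. by rewrite -mul_mpolyC; apply/diff_polyM/diff_polyC. Qed.

Lemma diff_poly0 : diff_poly 0.
Proof. by rewrite -mpolyC0; apply: diff_polyC. Qed.

Lemma diff_poly1 : diff_poly 1.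
Proof. by rewrite -mpolyC1; apply: diff_polyC. Qed.

Lemma diff_polyB f g : diff_poly f -> diff_poly g -> diff_poly (f - g).
Proof.
by move=> fd gd; rewrite -[- g]scaleN1r; apply: diff_polyD => //;
  apply: diff_polyZ.
Qed.

Lemma diff_poly_sum (J : Type) (r : seq J) (Q : pred J) (F : J -> P) :
  (forall e, Q e -> diff_poly (F e)) -> diff_poly (\sum_(e <- r | Q e) F e).
Proof. by move=> dF; apply: big_ind => //;
  [exact: diff_poly0 | exact: diff_polyD]. Qed.

Lemma diff_poly_prod (J : Type) (r : seq J) (Q : pred J) (F : J -> P) :
  (forall e, Q e -> diff_poly (F e)) -> diff_poly (\prod_(e <- r | Q e) F e).
Proof. by move=> dF; apply: big_ind => //;
  [exact: diff_poly1 | exact: diff_polyM]. Qed.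

Lemma diff_polyXn f (d : nat) : diff_poly f -> diff_poly (f ^+ d).
Proof.
move=> fd; elim: d => [|d IHd]; first exact: diff_poly1.
by rewrite exprS; apply: diff_polyM.
Qed.

Lemma diff_poly_subspace : is_subspace diff_poly.
Proof. by split; [exact: diff_poly0 | exact: diff_polyD | exact: diff_polyZ].
  Qed.

Lemma diff_poly_msym s f : diff_poly f -> diff_poly (msym s f).
Proof.
elim=> [a|i j|{}f g _ IHf _ IHg|{}f g _ IHf _ IHg].
- by rewrite msymC; apply: diff_polyC.
- by rewrite msymB !msymXU; apply: diff_polyX.
- by rewrite msymD; apply: diff_polyD.
- by rewrite msymM; apply: diff_polyM.
Qed.

Lemma diff_poly_mderiv i f : diff_poly f -> diff_poly f^`M(i).
Proof.
elim=> [a|j k|{}f g fd IHf gd IHg|{}f g fd IHf gd IHg].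
- by rewrite mderivC; apply: diff_poly0.
- by rewrite mderivB !mderivX1 -mpolyCB; apply: diff_polyC.
- by rewrite mderivD; apply: diff_polyD.
- by rewrite mderivM; apply: diff_polyD; apply: diff_polyM.
Qed.

Lemma diff_poly_divdiff i j f : i != j -> diff_poly f ->
  diff_poly (divdiff i j f).
Proof.
move=> nij; elim=> [a|k l|{}f g fd IHf gd IHg|{}f g fd IHf gd IHg].
- by rewrite divdiff_sym ?msymC //; apply: diff_poly0.
- rewrite -scaleN1r (divdiffD nij) (divdiffZ _ nij) !divdiffX //.
  by apply: diff_polyD; [|apply: diff_polyZ]; apply: diff_polyC.
- by rewrite (divdiffD nij); apply: diff_polyD.
- rewrite (divdiffMl _ _ nij); apply: diff_polyD; apply: diff_polyM => //.
  exact: diff_poly_msym.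
Qed.

Lemma diff_poly_dunkl c i f : diff_poly f -> diff_poly (dunkl_op c i f).
Proof.
move=> fd; rewrite dunkl_opE; apply: diff_polyD; first exact: diff_poly_mderiv.
apply/diff_polyZ/diff_poly_sum => j nj.
by apply: diff_poly_divdiff => //; rewrite eq_sym.
Qed.

Lemma diff_poly_pihomog d f : diff_poly f -> diff_poly (pihomog mdeg d f).
Proof.
move=> fd; elim: fd d => [a|j k|{}f g fd IHf gd IHg|{}f g fd IHf gd IHg] d.
- have -> : a%:MP = a *: 'X_[0%MM] :> P by rewrite mpolyX0 alg_mpolyC.
  rewrite linearZ /= pihomogX mpolyX0; case: ifP => _.
    by apply/diff_polyZ/diff_poly1.
  by rewrite scaler0; apply: diff_poly0.
- have hX : ('X_j - 'X_k : P) \is 1.-homog by apply: rpredB; apply: dhomogXU.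
  case: (eqVneq 1%N d) => [<-|d1]; first by rewrite pihomog_dE //;
    apply: diff_polyX.
  by rewrite (pihomog_ne0 d1 hX); apply: diff_poly0.
- by rewrite pihomogD; apply: diff_polyD.
- rewrite pihomogMM; apply: diff_poly_sum => e _; exact: diff_polyM.
Qed.

(** Infinitesimal form of the invariance of differences under simultaneous translation of all
    variables. *)
Lemma diff_poly_sum_mderiv f : diff_poly f -> \sum_(i < n) f^`M(i) = 0.
Proof.
elim=> [a|j k|{}f g fd IHf gd IHg|{}f g fd IHf gd IHg].
- by rewrite big1 // => i _; rewrite mderivC.
- have XE l : \sum_(i < n) 'X_l^`M(i) = 1 :> P.
    rewrite (bigD1 l) //= mderivX1 eqxx mpolyC1 big1 ?addr0 // => i nil.
    by rewrite mderivX1 eq_sym (negbTE nil) mpolyC0.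
  under eq_bigr => i _ do rewrite mderivB.
  by rewrite big_split sumrN /= !XE subrr.
- under eq_bigr => i _ do rewrite mderivD.
  by rewrite big_split /= IHf IHg addr0.
- under eq_bigr => i _ do rewrite mderivM.
  by rewrite big_split /= -mulr_suml -mulr_sumr IHf IHg mul0r mulr0 addr0.
Qed.

Lemma dunkl_ev_stable c (J : set P) : is_subspace J ->
  (forall i j f, J f -> J (dunkl_op c i f - dunkl_op c j f)) ->
  forall b, diff_poly b -> forall f, J f -> J (dunkl_ev c b f).
Proof.
move=> [J0 JD JZ] JX b; elim=> [a|j k|b1 b2 _ IH1 _ IH2|b1 b2 _ IH1 _ IH2] f Jf.
- by rewrite -alg_mpolyC dunkl_evZl dunkl_ev1; apply: JZ.
- rewrite -scaleN1r dunkl_evDl dunkl_evZl !dunkl_evXU scaleN1r; exact: JX.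
- by rewrite dunkl_evDl; apply: JD; [apply: IH1 | apply: IH2].
- by rewrite dunkl_evM; apply/IH1/IH2.
Qed.

Definition center (i : 'I_n) : P := 'X_i - (n%:R)^-1 *: \sum_(j < n) 'X_j.

(** An algebra projection of the full polynomial ring onto the ring of differences. *)
Definition centering f : P := f \mPo [tuple center i | i < n].

Hypothesis n_gt0 : (0 < n)%N.

Let n_neq0 : n%:R != 0 :> K.
Proof. by rewrite pnatr_eq0 -lt0n. Qed.

Lemma diff_poly_center i : diff_poly (center i).
Proof.
have -> : center i = n%:R^-1 *: \sum_(j < n) ('X_i - 'X_j).
  rewrite sumrB sumr_const card_ord scalerBr -scaler_nat scalerA mulVf //.
  by rewrite scale1r.
by apply/diff_polyZ/diff_poly_sum => j _; apply: diff_polyX.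
Qed.

Lemma centeringXU i : centering 'X_i = center i.
Proof. by rewrite /centering comp_mpolyXU -tnth_nth tnth_mktuple. Qed.

Lemma diff_poly_centering f : diff_poly (centering f).
Proof.
elim/mpoly_ind_X: f => [f g Hf Hg|a f Hf||k f Hf]; rewrite /centering.
- by rewrite comp_mpolyD; apply: diff_polyD.
- by rewrite comp_mpolyZ; apply: diff_polyZ.
- by rewrite comp_mpoly1; apply: diff_poly1.
- by rewrite rmorphM; apply: diff_polyM => //=;
  rewrite -/(centering _) centeringXU;
    apply: diff_poly_center.
Qed.

Lemma centering_id f : diff_poly f -> centering f = f.
Proof.
elim=> [a|j k|{}f g fd IHf gd IHg|{}f g fd IHf gd IHg].
- by rewrite /centering comp_mpolyC.
- rewrite /centering comp_mpolyB -!/(centering _) !centeringXU /center.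
  by rewrite opprB addrA addrNK.
- by rewrite /centering comp_mpolyD -!/(centering _) IHf IHg.
- by rewrite /centering rmorphM /= -!/(centering _) IHf IHg.
Qed.

(** [centering] is multiplicative and fixes [g] and [g * f]; cancelling [g] shows that it fixes
    [f]. *)
Lemma diff_poly_divl f g : g != 0 -> diff_poly g -> diff_poly (g * f) ->
  diff_poly f.
Proof.
move=> g0 gd gfd; suff <- : centering f = f by apply: diff_poly_centering.
apply: (mulfI g0); have := centering_id gfd.
by rewrite /centering rmorphM /= -!/(centering _) (centering_id gd).
Qed.

End DifferenceRing.

(** * The shift by the Vandermonde determinant *)

HB.lock Definition vandermonde (K : numFieldType) (n : nat) : {mpoly K[n]} :=
  \prod_(i < n) \prod_(j < n | (i < j)%N) ('X_i - 'X_j).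

Section Vandermonde.
Variables (K : numFieldType) (n : nat).
Local Notation P := {mpoly K[n]}.
Local Notation W := (vandermonde K n).
Implicit Types (f g h p q : P) (a c : K) (i j k : 'I_n) (s : 'S_n) (u :
  'X_{1..n}).

Lemma vandermonde_pairE :
  W = \prod_(e : 'I_n * 'I_n | (e.1 < e.2)%N) ('X_e.1 - 'X_e.2).
Proof. by rewrite vandermonde.unlock pair_big_dep. Qed.

Lemma vandermonde_neq0 : W != 0.
Proof.
rewrite vandermonde_pairE; apply/prodf_neq0 => e ei; apply: mpolyX_sub_neq0.
by rewrite neq_ltn ei.
Qed.

Lemma diff_poly_vandermonde : diff_poly W.
Proof.
by rewrite vandermonde_pairE; apply: diff_poly_prod => e _; apply: diff_polyX.
Qed.

Lemma msym_vandermonde s : msym s W = (-1) ^+ s *: W.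
Proof.
pose V : 'M[P]_n := Vandermonde n (\row_i 'X_i).
(* The determinant is the product of the opposite differences [X_j - X_i]; the signs are collected
   in a constant, which permutations fix. *)
have WE : W = (\prod_(i < n) \prod_(j < n | (i < j)%N) -1) * \det V.
  rewrite det_Vandermonde vandermonde.unlock -big_split /=;
    apply: eq_bigr => i _.
  rewrite -big_split /=; apply: eq_bigr => j _.
  by rewrite !mxE mulN1r opprB.
have EE : msym s (\prod_(i < n) \prod_(j < n | (i < j)%N) -1) =
          \prod_(i < n) \prod_(j < n | (i < j)%N) (-1 : P).
  rewrite (rmorph_prod (msym s)); apply: eq_bigr => i _.
  rewrite (rmorph_prod (msym s)); apply: eq_bigr => j _.
  by rewrite /= rmorphN1.
have VE : msym s (\det V) = (-1) ^+ s *: \det V.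
  rewrite -(det_map_mx (msym s)).
  have -> : map_mx (msym s) V = col_perm s V.
    by apply/matrixP => i j; rewrite !mxE rmorphXn /= msymXU.
  rewrite col_permE det_mulmx det_perm odd_permV mulrC.
  by rewrite -[in RHS]mul_mpolyC rmorph_sign.
by rewrite [in LHS]WE msymM EE VE -scalerAr -WE.
Qed.

Lemma msym_tperm_vandermonde i j : i != j -> msym (tperm i j) W = - W.
Proof. by move=> nij; rewrite msym_vandermonde odd_tperm nij expr1 scaleN1r.
  Qed.

Lemma vandermonde_degree : exists2 N, (2 * N = n * n.-1)%N & W \is N.-homog.
Proof.
exists (\sum_(e : 'I_n * 'I_n | (e.1 < e.2)%N) 1)%N.
  rewrite -(pair_big_dep predT (fun i j : 'I_n => (i < j)%N) (fun _ _ =>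
    1%N)) /=.
  rewrite mul2n -addnn {2}(exchange_big_dep predT) //= -big_split /=.
  rewrite (eq_bigr (fun=> n.-1)) ?sum_nat_const ?card_ord // => i _.
  have -> : n.-1 = (\sum_(j < n | j != i) 1)%N.
    by rewrite sum1_card cardC1 card_ord.
  rewrite [RHS](bigID (fun j : 'I_n => (i < j)%N)) /=; congr (_ + _)%N;
    apply: eq_bigl => j.
    by rewrite -(inj_eq val_inj) /=; case: ltngtP.
  by rewrite -(inj_eq val_inj) /=; case: ltngtP.
rewrite vandermonde_pairE; elim/big_rec2: _ => [|e d p _ pd];
  first exact: dhomog1.
by apply: dhomogM => //; apply: rpredB; apply: dhomogXU.
Qed.

Definition merge_var i j f : P := f \mPo [tuple 'X_(if k == i then j else k) |
  k < n].

Lemma merge_varXU i j k : merge_var i j 'X_k = 'X_(if k == i then j else k).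
Proof. by rewrite /merge_var comp_mpolyXU -tnth_nth tnth_mktuple. Qed.

Lemma merge_varM i j f g : merge_var i j (f * g) =
  merge_var i j f * merge_var i j g.
Proof. exact: rmorphM. Qed.

Lemma merge_varB i j f g : merge_var i j (f - g) =
  merge_var i j f - merge_var i j g.
Proof. exact: rmorphB. Qed.

Lemma merge_var_dvd i j f : merge_var i j f = 0 ->
  exists q, f = ('X_i - 'X_j) * q.
Proof.
move=> f0; suff [q] : exists q, f - merge_var i j f = ('X_i - 'X_j) * q.
  by rewrite f0 subr0 => ?; exists q.
elim/mpoly_ind_X: {f0} f => [f g [p Hp] [q Hq]|a f [p Hp]||k f [p Hp]].
- by exists (p + q); rewrite /merge_var comp_mpolyD opprD addrACA Hp Hq mulrDr.
- by exists (a *: p); rewrite /merge_var comp_mpolyZ -scalerBr Hp scalerAr.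
- by exists 0; rewrite /merge_var comp_mpoly1 subrr mulr0.
rewrite merge_varM merge_varXU; case: eqP => [->|_]; last first.
  by exists ('X_k * p); rewrite -mulrBr Hp mulrCA.
exists (f + 'X_j * p); rewrite mulrDr mulrCA -Hp.
by ring.
Qed.

Lemma merge_var_antisym i j f : i != j -> msym (tperm i j) f = - f ->
  merge_var i j f = 0.
Proof.
move=> nij fa; have := divdiffP i j f;
  rewrite fa -opprD => /(congr1 (merge_var i j)).
rewrite merge_varM merge_varB !merge_varXU eqxx [j == i]eq_sym (negbTE nij)
  subrr mulr0.
rewrite /merge_var rmorphN rmorphD /= => /eqP; rewrite eq_sym oppr_eq0 -mulr2n.
by rewrite -scaler_nat mscalerI pnatr_eq0 => /eqP.
Qed.

(* Each [X_i - X_j] is prime, being the generator of the kernel of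
   [merge_var i j]. *)
Lemma vandermonde_dvd f : (forall s, msym s f = (-1) ^+ s *: f) ->
  exists2 q, f = W * q & q \is symmetric.
Proof.
move=> fa; suff [q fE] : exists q, f = W * q.
  exists q => //; apply/issymP => s; apply: (mulfI vandermonde_neq0).
  have := fa s; rewrite fE msymM msym_vandermonde -!scalerAl.
  by apply: scalerI; rewrite signr_eq0.
have f0 i j : i != j -> merge_var i j f = 0.
  move=> nij; apply: merge_var_antisym => //.
  by rewrite fa odd_tperm nij expr1 scaleN1r.
rewrite vandermonde_pairE -big_filter; set r := [seq e <- _ | _].
have : all (fun e : 'I_n * 'I_n => (e.1 < e.2)%N) r by rewrite filter_all.
have : uniq r by rewrite filter_uniq ?index_enum_uniq.
elim: r => [|[i j] r IHr] /=; first by exists f; rewrite big_nil mul1r.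
move=> /andP[er ur] /andP[lij lr]; have [q fE] := IHr ur lr.
have nij : i != j by rewrite neq_ltn lij.
have : merge_var i j q = 0.
  have /eqP := f0 _ _ nij; rewrite fE merge_varM mulf_eq0 => /orP[|/eqP//].
  rewrite /merge_var rmorph_prod /= prodf_seq_eq0 => /hasP[[k l] klr /=].
  rewrite -!/(merge_var _ _ _) merge_varB !merge_varXU => klE.
  have /negP[] : 'X_(if k == i then j else k) - 'X_(if l == i then j else l) !=
    0 :> P.
    (* Merging [i] into [j] kills [X_k - X_l] only if {k, l} = {i, j}; with k < l and i < j this
       means (k, l) = (i, j), which is not in [r]. *)
    apply: mpolyX_sub_neq0; have /= lkl := allP lr _ klr.
    case: (eqVneq k i) => [ki|ki]; case: (eqVneq l i) => [li|li].
    - by rewrite ki li ltnn in lkl.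
    - apply: contraNneq er => jl; by rewrite jl -ki.
    - apply: contraTneq lkl => ->; by rewrite li -leqNgt ltnW.
    - by rewrite neq_ltn lkl.
  exact: klE.
move=> /merge_var_dvd[q' qE]; exists q'.
by rewrite big_cons fE qE mulrCA mulrA.
Qed.

(** Logarithmic derivative with denominators cleared: [G e] is [h] times the logarithmic derivative
    of [F e]. *)
Lemma mderiv_prod_log i h (J : Type) (r : seq J) (Q : pred J) (F G : J -> P) :
  (forall e, Q e -> h * (F e)^`M(i) = G e * F e) ->
  h * (\prod_(e <- r | Q e) F e)^`M(i) =
  (\sum_(e <- r | Q e) G e) * \prod_(e <- r | Q e) F e.
Proof.
move=> FG; elim: r => [|e r IHr]; first by rewrite !big_nil mderivC mulr0 mul0r.
rewrite !big_cons; case: ifP => // /FG Fe.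
set x := \prod_(_ <- _ | _) _ in IHr *; set y := \sum_(_ <- _ | _) _ in IHr *.
rewrite mderivM mulrDr [h * (_ * x)]mulrA Fe [h * (F e * _)]mulrCA IHr.
by rewrite mulrDl [F e * (y * x)]mulrCA -mulrA.
Qed.

Lemma divdiff_vandermonde i j : i != j ->
  divdiff i j W * ('X_i - 'X_j) = - 2%:R *: W.
Proof.
by move=> nij; rewrite divdiffP msym_tperm_vandermonde // -opprD scaleNr
  scaler_nat mulr2n.
Qed.

(** As W changes sign under [s_ij], [divdiff i j W] is -2 W/(x_i - x_j), and the sum over j of
    1/(x_i - x_j) is the logarithmic derivative of W in x_i. Below, [V j k] is W/(x_j - x_k). *)
Lemma sum_divdiff_vandermonde i :
  \sum_(j < n | j != i) divdiff i j W = - 2%:R *: W^`M(i).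
Proof.
have two0 : - 2%:R != 0 :> K by rewrite oppr_eq0 pnatr_eq0.
pose V (j k : 'I_n) : P := (- 2%:R)^-1 *: divdiff j k W.
have VE j k : j != k -> V j k * ('X_j - 'X_k) = W.
  by move=> jk; rewrite -scalerAl divdiff_vandermonde // scalerA mulVf //
    scale1r.
have VC j k : j != k -> V k j = - V j k.
  by move=> jk; rewrite /V divdiffC // scalerN.
suff -> : W^`M(i) = \sum_(j < n | j != i) V i j.
  by rewrite -scaler_sumr scalerA mulfV // scale1r.
apply: (mulfI vandermonde_neq0).
rewrite {2}vandermonde_pairE (mderiv_prod_log _
  (G := fun e => V e.1 e.2 * ((e.1 == i)%:R - (e.2 == i)%:R)%:MP)); last first.
  move=> e lte; have ne : e.1 != e.2 by rewrite neq_ltn lte.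
  rewrite mderivB !mderivX1 -mpolyCB -{1}(VE _ _ ne) -!mulrA; congr (_ * _).
  exact: mulrC.
rewrite -vandermonde_pairE mulrC; congr (_ * _).
rewrite -(pair_big_dep predT (fun j k : 'I_n => (j < k)%N)
  (fun j k => V j k * ((j == i)%:R - (k == i)%:R)%:MP)) /=.
under eq_bigr => j _.
  under eq_bigr => k _ do rewrite mpolyCB mulrBr.
  rewrite big_split /=; over.
rewrite big_split /=.
have -> : \sum_(j < n) \sum_(k < n | (j < k)%N) V j k * ((j == i)%:R)%:MP =
   \sum_(k < n | (i < k)%N) V i k.
  rewrite (bigD1 i) //= eqxx [X in _ + X]big1 ?addr0 => [|j ji].
    by apply: eq_bigr => k _; rewrite mpolyC1 mulr1.
  by rewrite big1 // => k _; rewrite (negbTE ji) mpolyC0 mulr0.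
have -> : \sum_(j < n) \sum_(k < n | (j < k)%N) - (V j k * ((k == i)%:R)%:MP) =
   \sum_(j < n | (j < i)%N) V i j.
  rewrite (exchange_big_dep predT) //= (bigD1 i) //= eqxx.
  rewrite [X in _ + X]big1 ?addr0 => [|k ki].
    apply: eq_bigr => j ji; rewrite mpolyC1 mulr1 VC ?opprK //.
    by rewrite neq_ltn ji orbT.
  by rewrite big1 // => j _; rewrite (negbTE ki) mpolyC0 mulr0 oppr0.
rewrite [RHS](bigID (fun k : 'I_n => (i < k)%N)) /=; congr (_ + _).
  by apply: eq_bigl => k; rewrite -(inj_eq val_inj) /=; case: ltngtP.
by apply: eq_bigl => k; rewrite -(inj_eq val_inj) /=; case: ltngtP.
Qed.

(** The divided differences of [g] change sign because [s_ij W = - W]; those of W contribute the -2c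
    in the first coefficient. *)
Lemma dunkl_op_vandermonde c i g : dunkl_op c i (W * g) =
  (1 - 2%:R * c) *: (W^`M(i) * g) +
  W * (g^`M(i) - c *: \sum_(j < n | j != i) divdiff i j g).
Proof.
rewrite dunkl_opE mderivM.
have -> : \sum_(j < n | j != i) divdiff i j (W * g) =
    (- 2%:R *: W^`M(i)) * g - W * \sum_(j < n | j != i) divdiff i j g.
  rewrite -sum_divdiff_vandermonde mulr_suml mulr_sumr -sumrB;
    apply: eq_bigr => j ji.
  by rewrite eq_sym in ji; rewrite divdiffMr // msym_tperm_vandermonde // mulNr.
move: W^`M(i) g^`M(i) (\sum_(j < n | j != i) divdiff i j g) W => x y z w.
by rewrite -!mul_mpolyC !(mpolyCB, mpolyCM, mpolyCN, mpolyC1); ring.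
Qed.

(** The sum is antisymmetric, hence divisible by W, but its degree is lower by 2. *)
Lemma sum_dunkl_mderiv_vandermonde c : \sum_(i < n) dunkl_op c i W^`M(i) = 0.
Proof.
(* Partial derivatives are Dunkl operators of parameter 0, so the lemmas on degrees apply to
   them. *)
have mderivE i f : f^`M(i) = dunkl_op 0 i f by rewrite dunkl_opE scale0r addr0.
set S := \sum_(i < n) _.
have [q SE _] : exists2 q, S = W * q & q \is symmetric.
  apply: vandermonde_dvd => s; rewrite /S (raddf_sum (msym s)) /= scaler_sumr.
  rewrite [RHS](reindex_inj (@perm_inj _ s)) /=; apply: eq_bigr => i _.
  by rewrite dunkl_opJ mderivJ msym_vandermonde mderivZ dunkl_opZ.
have [[|[|N]] _ WN] := vandermonde_degree.
- by rewrite /S big1 // => i _;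
  rewrite mderivE (dunkl_op_homog0 0 i WN) dunkl_op0.
- rewrite /S big1 // => i _; rewrite dunkl_op_homog0 // mderivE.
  exact: dhomog_dunkl_op.
have SN : S \is N.-homog.
  by apply: rpred_sum => i _; rewrite mderivE; do 2! apply: dhomog_dunkl_op.
by rewrite -(pihomog_dE SN) SE mulrC (pihomogM _ _ WN) ltnNge leqnSn.
Qed.

Lemma dunkl_lap_sym c f : f \is symmetric -> dunkl_lap c f =
  \sum_(i < n) f^`M(i)^`M(i) +
  c *: \sum_(i < n) \sum_(j < n | j != i) divdiff i j f^`M(i).
Proof.
move=> fs; rewrite dunkl_lapE scaler_sumr -big_split; apply: eq_bigr => i _ /=.
by rewrite (dunkl_op_sym c i fs) dunkl_opE.
Qed.

(** The left side is the sum over i <> j of 2 W/(x_i - x_j) times the i-th derivative of [f].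
    Averaging with the exchanged pair gives differences of the i-th and j-th derivatives, and [s_ij]
    exchanges these derivatives since [f] is symmetric: divided differences appear. *)
Lemma sum_mderiv_vandermonde f : f \is symmetric ->
  2%:R *: \sum_(i < n) W^`M(i) * f^`M(i) =
  - (W * \sum_(i < n) \sum_(j < n | j != i) divdiff i j f^`M(i)).
Proof.
move=> /issymP fs; have two0 : 2%:R != 0 :> K by rewrite pnatr_eq0.
apply: (scalerI two0).
have -> : 2%:R *: \sum_(i < n) W^`M(i) * f^`M(i) =
    - \sum_(i < n) \sum_(j < n | j != i) divdiff i j W * f^`M(i).
  rewrite scaler_sumr -sumrN; apply: eq_bigr => i _.
  by rewrite -mulr_suml sum_divdiff_vandermonde scaleNr mulNr opprK scalerAl.
rewrite !scalerN; congr (- _); rewrite {1}scaler_nat mulr2n.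
rewrite {2}(exchange_big_dep predT) //= -big_split mulr_sumr scaler_sumr /=.
apply: eq_bigr => i _.
rewrite [X in _ + X](eq_bigl (fun j => j != i)) => [|j]; last by rewrite eq_sym.
rewrite -big_split mulr_sumr scaler_sumr /=; apply: eq_bigr => j ji.
have nij : i != j by rewrite eq_sym.
rewrite (divdiffC _ nij) mulNr -mulrBr.
apply: (mulIf (mpolyX_sub_neq0 K nij)).
rewrite -scalerAl -[W * _ * _]mulrA divdiffP mulrAC divdiff_vandermonde //.
have -> : msym (tperm i j) f^`M(i) = f^`M(j) by rewrite mderivJ tpermL fs.
by rewrite scaleNr mulNr -mulrN opprB scalerAl.
Qed.

(** The divided differences get -(1 - 2(c+1)) = 2c + 1 from the cross terms and -(c+1) from the sign
    change under W, in total c. *)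
Lemma dunkl_lap_vandermonde c f : f \is symmetric ->
  dunkl_lap (c + 1) (W * f) = W * dunkl_lap c f.
Proof.
move=> fs; pose d := 1 - 2%:R * (c + 1).
rewrite dunkl_lapE (eq_bigr (fun i => d *: (dunkl_op (c + 1) i W^`M(i) * f) +
    ((2%:R * d) *: (W^`M(i) * f^`M(i)) + W * (f^`M(i)^`M(i) -
     (c + 1) *: \sum_(j < n | j != i) divdiff i j f^`M(i))))); last first.
  move=> i _; rewrite [dunkl_op _ i (W * f)]dunkl_op_vandermonde.
  rewrite big1 => [|j ji]; last first.
    by rewrite divdiff_sym 1?eq_sym //; move/issymP: fs => ->.
  rewrite scaler0 subr0 dunkl_opD dunkl_opZ (dunkl_opM_sym _ _ W^`M(i) fs)
    dunkl_op_vandermonde.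
  rewrite -/d scalerDr -!addrA; congr (_ + _); rewrite addrA; congr (_ + _).
  by rewrite -scalerDl mulr_natl mulr2n.
rewrite big_split /= -scaler_sumr -mulr_suml sum_dunkl_mderiv_vandermonde.
rewrite mul0r scaler0 add0r big_split /= -scaler_sumr -mulr_sumr.
rewrite mulrC -scalerA sum_mderiv_vandermonde //.
rewrite dunkl_lap_sym // sumrB -scaler_sumr.
move: (\sum_(i < n) _) (\sum_(i < n) _) W => x y w.
by rewrite -!mul_mpolyC !(mpolyCB, mpolyCM, mpolyCD, mpolyC1, mpolyC_nat); ring.
Qed.

End Vandermonde.

(** * Power sums and the duality m/n <-> n/m *)

Section PowerSums.
Variables (K : numFieldType) (n : nat).
Hypothesis n_gt0 : (0 < n)%N.
Local Notation P := {mpoly K[n]}.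
Implicit Types (f g h p q : P) (a c : K) (i j : 'I_n) (k l : nat) (s : 'S_n).

Local Notation z := (@center K n).

Definition cpsum k : P := \sum_(i < n) z i ^+ k.

Let n_neq0 : n%:R != 0 :> K.
Proof. by rewrite pnatr_eq0 -lt0n. Qed.

Lemma msym_center s i : msym s (z i) = z (s i).
Proof.
rewrite /center msymB msymXU msymZ (raddf_sum (msym s));
  congr (_ - _ *: _) => /=.
rewrite [RHS](reindex_inj (@perm_inj _ s)) /=.
by apply: eq_bigr => j _; rewrite msymXU.
Qed.

Lemma dhomog_center i : z i \is 1.-homog.
Proof.
apply: rpredB; first exact: dhomogXU.
by apply: rpredZ; apply: rpred_sum => j _; apply: dhomogXU.
Qed.

Lemma cpsum_sym k : cpsum k \is symmetric.
Proof.
apply/issymP => s; rewrite /cpsum (raddf_sum (msym s)) /=.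
rewrite [RHS](reindex_inj (@perm_inj _ s)) /=.
by apply: eq_bigr => i _; rewrite rmorphXn /= msym_center.
Qed.

Lemma dhomog_cpsum k : cpsum k \is k.-homog.
Proof.
apply: rpred_sum => i _.
by have := dhomogMn k (dhomog_center i); rewrite mul1n.
Qed.

Lemma diff_poly_cpsum k : diff_poly (cpsum k).
Proof. by apply: diff_poly_sum => i _; apply/diff_polyXn/diff_poly_center. Qed.

Lemma cpsum0 : cpsum 0 = n%:R%:MP.
Proof.
by rewrite /cpsum; under eq_bigr do rewrite expr0;
  rewrite sumr_const card_ord mpolyC_nat.
Qed.

Lemma cpsum1 : cpsum 1 = 0.
Proof.
rewrite /cpsum; under eq_bigr do rewrite expr1 /center.
by rewrite sumrB sumr_const card_ord -scaler_nat scalerA mulfV // scale1r subrr.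
Qed.

Lemma mderiv_exp i k f : (f ^+ k.+1)^`M(i) = k.+1%:R *: (f ^+ k * f^`M(i)).
Proof.
elim: k => [|k IHk]; first by rewrite expr1 expr0 mul1r scale1r.
rewrite exprS mderivM IHk -[k.+2%:R]natr1 scalerDl scale1r addrC -scalerAr.
by rewrite mulrA -exprS mulrC.
Qed.

Lemma mderiv_center i j : (z j)^`M(i) = ((j == i)%:R - n%:R^-1)%:MP.
Proof.
rewrite /center mderivB mderivX1 mderivZ (raddf_sum (mderiv i)) /= (bigD1 i)
  //=.
rewrite mderivX1 eqxx big1 => [|l li];
  last by rewrite mderivX1 (negbTE li) mpolyC0.
by rewrite addr0 -[true%:R%:MP]alg_mpolyC scale1r alg_mpolyC mpolyCB.
Qed.

Lemma mderiv_center_exp i j k :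
  (z j ^+ k.+1)^`M(i) = (k.+1%:R * ((j == i)%:R - n%:R^-1)) *: z j ^+ k.
Proof.
by rewrite mderiv_exp mderiv_center mulrC mul_mpolyC scalerA.
Qed.

Lemma mderiv_cpsum i k :
  (cpsum k.+1)^`M(i) = k.+1%:R *: (z i ^+ k - n%:R^-1 *: cpsum k).
Proof.
rewrite {1}/cpsum (raddf_sum (mderiv i)) /= scalerBr [_ *: (_ *: _)]scalerA.
under eq_bigr => j _ do rewrite mderiv_center_exp mulrBr scalerBl.
rewrite sumrB -scaler_sumr; congr (_ - _).
rewrite (bigD1 i) //= eqxx mulr1 big1 ?addr0 // => j ji.
by rewrite (negbTE ji) mulr0 scale0r.
Qed.

(** The carre du champ: half the defect of the Laplacian from being a derivation on symmetric
    polynomials, by [dunkl_lapM_sym]. *)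
Definition carre f g : P := \sum_(i < n) f^`M(i) * g^`M(i).

Lemma carreC f g : carre f g = carre g f.
Proof. by apply: eq_bigr => i _; rewrite mulrC. Qed.

Lemma carreD f g h : carre (f + g) h = carre f h + carre g h.
Proof.
by rewrite -big_split; apply: eq_bigr => i _; rewrite mderivD mulrDl.
Qed.

Lemma carreM f g h : carre (f * g) h = f * carre g h + g * carre f h.
Proof.
rewrite !mulr_sumr -big_split; apply: eq_bigr => i _ /=; rewrite mderivM.
by move: f^`M(i) g^`M(i) h^`M(i) => x y t; ring.
Qed.

Lemma carreZ a f h : carre (a *: f) h = a *: carre f h.
Proof.
by rewrite scaler_sumr; apply: eq_bigr => i _; rewrite mderivZ scalerAl.
Qed.

Lemma carre_const a h : carre a%:MP h = 0.
Proof. by rewrite /carre big1 // => i _; rewrite mderivC mul0r. Qed.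

Lemma carre_cpsum k l : carre (cpsum k.+1) (cpsum l.+1) =
  (k.+1%:R * l.+1%:R) *: (cpsum (k + l) - n%:R^-1 *: (cpsum k * cpsum l)).
Proof.
rewrite /carre.
under eq_bigr => i _ do rewrite !mderiv_cpsum -scalerAl -scalerAr scalerA.
rewrite -scaler_sumr; congr (_ *: _); set a := _ *: cpsum k;
  set b := _ *: cpsum l.
have -> : \sum_(i < n) (z i ^+ k - a) * (z i ^+ l - b) =
    cpsum (k + l) - cpsum k * b - a * cpsum l + (a * b) *+ n.
  rewrite -[X in _ *+ X]card_ord -sumr_const mulr_suml mulr_sumr -!sumrB
    -big_split /=.
  by apply: eq_bigr => i _; rewrite exprD; ring.
rewrite -mulrnAr -scaler_nat scalerA mulfV // scale1r subrK.
by rewrite -scalerAr.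
Qed.

Lemma dunkl_lapM_sym c f g : f \is symmetric -> g \is symmetric ->
  dunkl_lap c (f * g) = dunkl_lap c f * g + f * dunkl_lap c g + 2%:R *: carre f
    g.
Proof.
move=> fs gs; rewrite !dunkl_lapE mulr_suml mulr_sumr scaler_sumr -!big_split
  /=.
apply: eq_bigr => i _; rewrite (dunkl_op_sym c i fs) (dunkl_op_sym c i gs).
rewrite (dunkl_op_sym c i (rpredM fs gs)) mderivM dunkl_opD.
rewrite (dunkl_opM_sym c i f^`M(i) gs).
have -> : dunkl_op c i (f * g^`M(i)) =
  dunkl_op c i g^`M(i) * f + g^`M(i) * f^`M(i).
  by rewrite mulrC (dunkl_opM_sym c i g^`M(i) fs).
rewrite scaler_nat.
move: (dunkl_op c i f^`M(i)) (dunkl_op c i g^`M(i)) f^`M(i) g^`M(i) => x y t w.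
by ring.
Qed.

Lemma dunkl_lap_const c a : dunkl_lap c (a%:MP : P) = 0.
Proof.
rewrite dunkl_lapE big1 // => i _.
by rewrite -alg_mpolyC dunkl_opZ dunkl_op1 scaler0 dunkl_op0.
Qed.

Lemma divdiff_center_exp i j k : i != j ->
  divdiff i j (z i ^+ k.+1) = - \sum_(e < k.+1) z i ^+ (k - e) * z j ^+ e.
Proof.
move=> nij; apply: divdiff_eq => //.
rewrite rmorphXn /= msym_center tpermL -[RHS]opprB subrXX mulNr.
rewrite [_ * ('X_i - 'X_j)]mulrC; congr (- (_ * _)).
by rewrite /center opprB addrA addrNK.
Qed.

Lemma dunkl_lap_cpsum1 c : dunkl_lap c (cpsum 1) = 0.
Proof. by rewrite cpsum1 linear0. Qed.

(** The divided differences give sums of z_i^(k-e) z_j^e over i <> j, that is products of power sums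
    minus p_k; these k+1 diagonal terms make up the c in the first coefficient. The -1/n comes from
    differentiating a centred variable. *)
Lemma dunkl_lap_cpsum c k : dunkl_lap c (cpsum k.+2) =
  k.+2%:R *: ((k.+1%:R * (1 - n%:R^-1 + c)) *: cpsum k
    - c *: \sum_(e < k.+1) cpsum (k - e) * cpsum e).
Proof.
rewrite dunkl_lap_sym ?cpsum_sym //.
have -> : \sum_(i < n) (cpsum k.+2)^`M(i)^`M(i) =
    (k.+2%:R * (k.+1%:R * (1 - n%:R^-1))) *: cpsum k.
  under eq_bigr => i _.
    rewrite mderiv_cpsum mderivZ mderivB mderivZ mderiv_center_exp eqxx
      scalerBr scalerA; over.
  rewrite sumrB -!scaler_sumr (diff_poly_sum_mderiv (diff_poly_cpsum _)).
  by rewrite !scaler0 subr0.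
have -> : \sum_(i < n) \sum_(j < n | j != i) divdiff i j (cpsum k.+2)^`M(i) =
    k.+2%:R *: (k.+1%:R *: cpsum k - \sum_(e < k.+1) cpsum (k - e) * cpsum e).
  have -> : k.+1%:R *: cpsum k =
    \sum_(e < k.+1) \sum_(i < n) z i ^+ (k - e) * z i ^+ e.
    rewrite scaler_nat -[X in _ *+ X]card_ord -sumr_const;
      apply: eq_bigr => e _.
    by apply: eq_bigr => i _; rewrite -exprD subnK // -ltnS.
  rewrite -sumrB scaler_sumr.
  rewrite [RHS](eq_bigr (fun e : 'I_k.+1 => \sum_(i < n) \sum_(j < n | j != i)
      k.+2%:R *: - (z i ^+ (k - e) * z j ^+ e))); last first.
    move=> e _; rewrite /cpsum mulr_suml -sumrB scaler_sumr;
      apply: eq_bigr => i _.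
    rewrite -scaler_sumr mulr_sumr [X in _ - X](bigD1 i) //= opprD addNKr.
    by rewrite sumrN.
  rewrite exchange_big /=; apply: eq_bigr => i _.
  rewrite exchange_big /=; apply: eq_bigr => j ji; rewrite eq_sym in ji.
  rewrite -scaler_sumr sumrN -divdiff_center_exp // mderiv_cpsum divdiffZ //.
  rewrite -scaleN1r divdiffD // !divdiffZ // [divdiff i j (cpsum _)]divdiff_sym
    //.
    by rewrite !scaler0 addr0.
  by move/issymP: (cpsum_sym k.+1) => ->.
have id (A B x : K) (p q : P) : (A * (B * x)) *: p + c *: (A *: (B *: p - q)) =
    A *: ((B * (x + c)) *: p - c *: q).
  by rewrite -!mul_mpolyC !(mpolyCD, mpolyCM); ring.
exact: id.
Qed.

End PowerSums.

(** * The correspondence of power sums in n and in m variables *)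

Section PowerSumDuality.
Variables (K : numFieldType) (n m : nat).
Hypotheses (n_gt0 : (0 < n)%N) (m_gt0 : (0 < m)%N).
Local Notation x := (m%:R / n%:R : K).

(** The correspondence underlying [canon_iso] before the ideals are divided out. Power sums in n
    variables satisfy relations that need not hold in m variables, so it is not a map. *)
Inductive psum_rel : {mpoly K[n]} -> {mpoly K[m]} -> Prop :=
| psum_rel_gen k of (0 < k)%N :
    psum_rel (cpsum K n k) ((n%:R / m%:R : K) *: cpsum K m k)
| psum_relC (a : K) : psum_rel a%:MP a%:MP
| psum_relD f g f' g' of psum_rel f f' & psum_rel g g' : psum_rel (f + g) (f' +
  g')
| psum_relM f g f' g' of psum_rel f f' & psum_rel g g' : psum_rel (f * g) (f' *
  g').

Let n_neq0 : n%:R != 0 :> K.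
Proof. by rewrite pnatr_eq0 -lt0n. Qed.

Let m_neq0 : m%:R != 0 :> K.
Proof. by rewrite pnatr_eq0 -lt0n. Qed.

Lemma psum_relZ a f f' : psum_rel f f' -> psum_rel (a *: f) (a *: f').
Proof. by move=> ff'; rewrite -!mul_mpolyC; apply: psum_relM => //;
  apply: psum_relC. Qed.

Lemma psum_rel0 : psum_rel 0 0.
Proof. by rewrite -!mpolyC0; apply: psum_relC. Qed.

Lemma psum_relB f f' g g' : psum_rel f f' -> psum_rel g g' ->
  psum_rel (f - g) (f' - g').
Proof.
move=> ff' gg'; rewrite -[- g]scaleN1r -[- g']scaleN1r.
by apply: psum_relD => //; apply: psum_relZ.
Qed.

Lemma psum_rel_sum (J : Type) (r : seq J) (F : J -> {mpoly K[n]}) (F' : J ->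
  {mpoly K[m]}) :
  (forall j, psum_rel (F j) (F' j)) ->
  psum_rel (\sum_(j <- r) F j) (\sum_(j <- r) F' j).
Proof.
move=> FF'; elim: r => [|j r IHr]; first by rewrite !big_nil; apply: psum_rel0.
by rewrite !big_cons; apply: psum_relD.
Qed.

(** The factor n/m is the one for which the rule persists at k = 0, where the power sums are n and
    m; the Laplacian does produce the index 0. *)
Lemma psum_rel_cpsum k : psum_rel (cpsum K n k) ((n%:R / m%:R : K) *: cpsum K m
  k).
Proof.
case: k => [|k]; last exact: psum_rel_gen.
rewrite !cpsum0 -mul_mpolyC -mpolyCM divfK //; exact: psum_relC.
Qed.

Lemma psum_rel_sym f f' : psum_rel f f' -> f \is symmetric /\ f' \is symmetric.
Proof.
elim=> [k _|a|{}f g {}f' g' _ [fs fs'] _ [gs gs']|{}f g {}f' g' _ [fs fs'] _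
  [gs gs']].
- by split; rewrite ?rpredZ // cpsum_sym.
- by split; apply/issymP => s; rewrite msymC.
- by split; apply: rpredD.
- by split; apply: rpredM.
Qed.

Lemma psum_rel_diff f f' : psum_rel f f' -> diff_poly f /\ diff_poly f'.
Proof.
elim=> [k _|a|{}f g {}f' g' _ [fs fs'] _ [gs gs']|{}f g {}f' g' _ [fs fs'] _
  [gs gs']].
- by split; [|apply: diff_polyZ]; apply: diff_poly_cpsum.
- by split; apply: diff_polyC.
- by split; apply: diff_polyD.
- by split; apply: diff_polyM.
Qed.

Lemma psum_rel_meval0 f f' : psum_rel f f' -> f.@[fun=> 0] = f'.@[fun=> 0].
Proof.
elim=> [[//|k] _|a|{}f g {}f' g' _ IHf _ IHg|{}f g {}f' g' _ IHf _ IHg].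
- rewrite mevalZ !(@meval0_homog _ _ k) ?mulr0 //; exact: dhomog_cpsum.
- by rewrite !mevalC.
- by rewrite !mevalD IHf IHg.
- by rewrite !mevalM IHf IHg.
Qed.

Lemma psum_rel_pihomog d f f' : psum_rel f f' ->
  psum_rel (pihomog mdeg d f) (pihomog mdeg d f').
Proof.
move=> ff'; elim: ff' d => [k _|a|{}f g {}f' g' _ IHf _ IHg|{}f g {}f' g' _ IHf
  _ IHg] d.
- rewrite [X in psum_rel _ X]linearZ /=; case: (eqVneq k d) => [<-|kd].
    by rewrite !pihomog_dE ?dhomog_cpsum //; apply: psum_rel_cpsum.
  by rewrite !(pihomog_ne0 kd) ?dhomog_cpsum // scaler0; apply: psum_rel0.
- have hC l : (a%:MP : {mpoly K[l]}) \is 0.-homog.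
    by rewrite -alg_mpolyC rpredZ // dhomog1.
  case: (eqVneq 0%N d) => [<-|kd].
    by rewrite !pihomog_dE //; apply: psum_relC.
  by rewrite !(pihomog_ne0 kd) //; apply: psum_rel0.
- by rewrite !pihomogD; apply: psum_relD.
- by rewrite !pihomogMM; apply: psum_rel_sum => e; apply: psum_relM.
Qed.

Lemma psum_rel_carre f f' g g' : psum_rel f f' -> psum_rel g g' ->
  psum_rel (carre f g) (x *: carre f' g').
Proof.
move=> ff' gg'.
elim: ff' => [[//|k] _|a|{}f h {}f' h' _ IHf _ IHh|{}f h {}f' h' ff' IHf hh'
  IHh].
- elim: gg' => [[//|l] _|a|{}g h {}g' h' _ IHg _ IHh|{}g h {}g' h' gg' IHg hh'
  IHh].
  + rewrite carreZ [carre (cpsum K m _) _]carreC carreZ (carre_cpsum K n_gt0)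
    (carre_cpsum K m_gt0).
    set p := cpsum K m (l + k); set q := cpsum K m l; set r := cpsum K m k.
    have -> : x *: ((n%:R / m%:R) *: ((n%:R / m%:R) *: ((l.+1%:R * k.+1%:R) *:
        (p - m%:R^-1 *: (q * r))))) =
      (k.+1%:R * l.+1%:R) *: ((n%:R / m%:R) *: p -
        n%:R^-1 *: (((n%:R / m%:R) *: r) * ((n%:R / m%:R) *: q))).
      rewrite -scalerAl -scalerAr [r * q]mulrC !scalerBr !scalerA.
      by congr (_ *: _ - _ *: _); field; rewrite m_neq0 n_neq0.
    apply/psum_relZ/psum_relB; first by rewrite /p addnC; apply: psum_rel_cpsum.
    by apply/psum_relZ/psum_relM; apply: psum_rel_cpsum.
  + by rewrite carreC [X in _ *: X]carreC !carre_const scaler0;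
    apply: psum_rel0.
  + rewrite carreC carreD [X in _ *: X]carreC carreD scalerDr ![carre _ (cpsum
    _ _ _)]carreC.
    by rewrite ![carre _ (_ *: cpsum _ _ _)]carreC; apply: psum_relD.
  + rewrite carreC carreM [X in _ *: X]carreC carreM scalerDr ![carre _ (cpsum
    _ _ _)]carreC.
    by rewrite ![carre _ (_ *: cpsum _ _ _)]carreC !scalerAr; apply: psum_relD;
      apply: psum_relM.
- by rewrite !carre_const scaler0; apply: psum_rel0.
- by rewrite !carreD scalerDr; apply: psum_relD.
- by rewrite !carreM scalerDr !scalerAr; apply: psum_relD; apply: psum_relM.
Qed.

(* In terms of power sums the symmetric part of the Dunkl Laplacian is a
   Calogero-Moser operator, and the substitution [p_k = (n/m) p'_k] exchanges
   the parameters [m/n] and [n/m] up to the overall factor [m/n]. *)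
Lemma psum_rel_lap f f' : psum_rel f f' ->
  psum_rel (dunkl_lap x f) (x *: dunkl_lap (n%:R / m%:R) f').
Proof.
elim=> [[//|[|k]] _|a|{}f g {}f' g' ff' IHf gg' IHg|{}f g {}f' g' ff' IHf gg'
  IHg].
- rewrite linearZ /= !dunkl_lap_cpsum1 // !scaler0; apply: psum_rel0.
- rewrite linearZ /= !dunkl_lap_cpsum // !scalerA.
  set p := cpsum K m k.
  have -> : \sum_(e < k.+1) cpsum K m (k - e) * cpsum K m e =
      (x ^+ 2) *: \sum_(e < k.+1) ((n%:R / m%:R) *: cpsum K m (k - e)) *
         ((n%:R / m%:R) *: cpsum K m e).
    rewrite scaler_sumr; apply: eq_bigr => e _.
    rewrite -scalerAl -scalerAr !scalerA -[LHS]scale1r; congr (_ *: _).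
    by field; rewrite m_neq0 n_neq0.
  set S := \sum_(e < k.+1) (_ *: _) * _.
  have -> : (x * (n%:R / m%:R) * k.+2%:R) *: ((k.+1%:R * (1 - m%:R^-1 + n%:R /
    m%:R)) *: p -
      (n%:R / m%:R) *: (x ^+ 2 *: S)) =
    k.+2%:R *: ((k.+1%:R * (1 - n%:R^-1 + x)) *: ((n%:R / m%:R) *: p) - x *: S).
    (* With the parameters m/n and n/m the coefficient of [p] is (k+2)(k+1)(m+n-1)/m on both
       sides. *)
    rewrite !scalerBr !scalerA.
    by congr (_ *: _ - _ *: _); field; rewrite m_neq0 n_neq0.
  apply/psum_relZ/psum_relB; first exact/psum_relZ/psum_rel_cpsum.
  by apply/psum_relZ/psum_rel_sum => e; apply: psum_relM; apply: psum_rel_cpsum.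
- by rewrite !dunkl_lap_const scaler0; apply: psum_rel0.
- by rewrite !linearD; apply: psum_relD.
have [[fs fs'] [gs gs']] := (psum_rel_sym ff', psum_rel_sym gg').
have -> : x *: dunkl_lap (n%:R / m%:R) (f' * g') =
    (x *: dunkl_lap (n%:R / m%:R) f') * g' + f' * (x *: dunkl_lap (n%:R / m%:R)
      g')
    + 2%:R *: (x *: carre f' g').
  by rewrite dunkl_lapM_sym // !scalerDr -scalerAl -scalerAr !scalerA [2%:R *
    x]mulrC.
rewrite dunkl_lapM_sym //.
apply: psum_relD; first by apply: psum_relD; apply: psum_relM.
exact/psum_relZ/psum_rel_carre.
Qed.

Lemma psum_rel_pair d b b' f f' : psum_rel b b' -> psum_rel f f' ->
  b \is d.-homog -> b' \is d.-homog ->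
  dunkl_pair (n%:R / m%:R) f' b' = 0 -> dunkl_pair x f b = 0.
Proof.
move=> bb' ff' bd b'd; rewrite ![dunkl_pair _ _ b]dunkl_pairC ![dunkl_pair _ _
  b']dunkl_pairC.
have /psum_rel_meval0 := dunkl_ev_transfer psum_relB psum_rel_lap
  (fun f f' => psum_relM bb') bd b'd ff'.
rewrite !mevalZ -!dunkl_pairE => + p0; rewrite p0 mulr0 => /eqP.
by rewrite !mulf_eq0 expf_eq0 !pnatr_eq0 andbF eqn0Ngt fact_gt0 => /eqP.
Qed.

(** Power sums generate the symmetric polynomials. Induction on the number of variables in a
    monomial u: if v is u without x_i^k, the product of the k-th power sum with [T v] is a positive
    multiple of [T u] plus terms [T w] whose w has the same variables as v. *)
Lemma psum_rel_total f : f \is symmetric -> diff_poly f ->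
  exists f', psum_rel f f'.
Proof.
move=> fs fd; rewrite -(centering_id fd).
(* The generation argument runs in the full polynomial ring; [centering] turns its power sums into
   the centred ones. *)
pose good g := exists g', psum_rel (centering g) g'.
have goodD g h : good g -> good h -> good (g + h).
  move=> [g' gg'] [h' hh']; exists (g' + h').
  by rewrite /centering comp_mpolyD; apply: psum_relD.
have goodM g h : good g -> good h -> good (g * h).
  move=> [g' gg'] [h' hh']; exists (g' * h').
  by rewrite /centering rmorphM; apply: psum_relM.
have goodC a : good a%:MP.
  by exists a%:MP; rewrite /centering comp_mpolyC; apply: psum_relC.
have goodZ a g : good g -> good (a *: g) by rewrite -mul_mpolyC; apply: goodM.
have good0 : good 0 by rewrite -mpolyC0.
have good_sum (J : Type) (r : seq J) (Q : pred J) F :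
    (forall j, Q j -> good (F j)) -> good (\sum_(j <- r | Q j) F j).
  by move=> ?; apply: big_ind.
have good_psum k : (0 < k)%N -> good (\sum_(j < n) 'X_j ^+ k).
  move=> k0; exists ((n%:R / m%:R : K) *: cpsum K m k).
  rewrite /centering raddf_sum /=.
  under eq_bigr => j _ do rewrite rmorphXn /= -/(centering _) centeringXU.
  exact: psum_rel_gen.
pose T (u : 'X_{1..n}) : {mpoly K[n]} := \sum_(s : 'S_n) msym s 'X_[u].
have TJ (t : 'S_n) (u v : 'X_{1..n}) : msym t 'X_[u] = 'X_[v] :> {mpoly K[n]} ->
  T v = T u.
  move=> uv; rewrite /T [RHS](reindex_inj (mulgI t)) /=.
  by apply: eq_bigr => s _; rewrite msymMm uv.
suff goodT u : good (T u).
  have -> : f = (n`!%:R)^-1 *: \sum_(s : 'S_n) msym s f.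
    under eq_bigr => s _ do rewrite (issymP _ fs).
    rewrite sumr_const card_Sn -scaler_nat scalerA mulVf ?scale1r //.
    by rewrite pnatr_eq0 -lt0n fact_gt0.
  have -> : \sum_(s : 'S_n) msym s f = \sum_(u <- msupp f) f@_u *: T u.
    rewrite {1}[f]mpolyE /T; under [RHS]eq_bigr do rewrite scaler_sumr.
    rewrite [RHS]exchange_big /=; apply: eq_bigr => s _.
    by rewrite (raddf_sum (msym s)) /=; apply: eq_bigr => u _; rewrite msymZ.
  by apply/goodZ/good_sum => u _; apply: goodZ.
pose supp (u : 'X_{1..n}) := [pred i | u i != 0%N].
have [N] := ubnP #|supp u|; elim: N u => // N IHN u; rewrite ltnS => uN.
have [i /= ui|u0] := pickP (fun i => u i != 0%N); last first.
  have -> : u = 0%MM by apply/mnmP => i; rewrite mnm0E; apply/eqP/negbFE/u0.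
  rewrite /T mpolyX0; under eq_bigr do rewrite msym1.
  by rewrite sumr_const -mpolyC_nat; apply: goodC.
pose k := u i; pose v := (u - U_(i) *+ k)%MM.
have vE j : v j = if j == i then 0%N else u j.
  rewrite mnmBE mulmnE mnm1E [i == j]eq_sym; case: eqP => [->|_].
    by rewrite mul1n subnn.
  by rewrite mul0n subn0.
have ltv : (#|supp v| < #|supp u|)%N.
  apply: proper_card; apply/properP; split; last by exists i;
    rewrite !inE ?vE ?eqxx.
  by apply/fintype.subsetP => j; rewrite !inE vE; case: ifP.
have mulT : (\sum_(j < n) 'X_j ^+ k) * T v = \sum_(l < n) T (v + U_(l) *+ k)%MM.
  rewrite /T mulr_sumr [RHS]exchange_big /=; apply: eq_bigr => s _.
  rewrite mulr_suml (reindex_inj (@perm_inj _ s)) /=; apply: eq_bigr => l _.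
  by rewrite mpolyXD msymM mulrC -mpolyXn rmorphXn /= msymXU.
have TE l : v l = 0%N -> T (v + U_(l) *+ k)%MM = T u.
  move=> vl; apply: (TJ (tperm i l)); rewrite msymX tpermV; congr 'X_[_].
  apply/mnmP => j; rewrite mnmE mnmDE mulmnE mnm1E !vE.
  case: tpermP => [->|->|/eqP ji /eqP jl].
  - rewrite eqxx add0n; case: eqP => [->|/eqP li]; first by rewrite mul1n.
    by move: vl; rewrite vE (negbTE li) mul0n.
  - by rewrite -[X in (X + _)%N]vE vl eqxx mul1n.
  - by rewrite (negbTE ji) eq_sym (negbTE jl) mul0n addn0.
pose A := [pred l | v l == 0%N].
pose M := #|A|; pose S := \sum_(l < n | l \notin A) T (v + U_(l) *+ k)%MM.
have TuE : (\sum_(j < n) 'X_j ^+ k) * T v = T u *+ M + S.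
  rewrite mulT (bigID (mem A)) /= (eq_bigr (fun=> T u)) => [|l /eqP/TE//].
  by rewrite sumr_const.
have M0 : M%:R != 0 :> K.
  by rewrite pnatr_eq0 -lt0n; apply/card_gt0P; exists i; rewrite inE /= vE eqxx.
have -> : T u = M%:R^-1 *: ((\sum_(j < n) 'X_j ^+ k) * T v - S).
  by rewrite TuE addrK -scaler_nat scalerA mulVf // scale1r.
apply/goodZ; rewrite -[- S]scaleN1r; apply: goodD.
  by apply: goodM; [apply: good_psum; rewrite lt0n | apply/IHN/(leq_trans ltv)].
apply/goodZ/good_sum => l vl; apply/IHN/(leq_trans _ uN)/(leq_trans _ ltv).
rewrite ltnS; apply: subset_leq_card; apply/fintype.subsetP => j;
  rewrite !inE mnmDE mulmnE mnm1E.
by case: (eqVneq l j) => [<- _|_]; [move: vl;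
  rewrite inE | rewrite mul0n addn0].
Qed.

End PowerSumDuality.

(** * Powers of the ideal of positive invariants *)

Lemma lspan_subspace (K : nzRingType) (V : lmodType K) (A : set V) :
  is_subspace (lspan A).
Proof. by split; [exact: lspan0 | exact: lspanD | move=> a u;
  exact: lspanZ]. Qed.

Lemma lspan_min (K : nzRingType) (V : lmodType K) (A U : set V) :
  is_subspace U -> A `<=` U -> lspan A `<=` U.
Proof.
move=> [U0 UD UZ] AU v; elim=> [|{}v /AU//|u {}v _ Uu _ Uv|a {}v _ Uv] //.
  exact: UD.
exact: UZ.
Qed.

Lemma lspan_mono (K : nzRingType) (V : lmodType K) (A B : set V) :
  A `<=` B -> lspan A `<=` lspan B.
Proof.
move=> AB; apply: lspan_min; first exact: lspan_subspace.
by move=> v /AB; apply: lspan_in.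
Qed.

Lemma lspan_linear (K : nzRingType) (V V' : lmodType K) (L : V ->
  V') (A : set V)
    (U : set V') : linear L -> is_subspace U -> (forall v, A v -> U (L v)) ->
  forall v, lspan A v -> U (L v).
Proof.
move=> linL [U0 UD UZ] AU; have L0 : L 0 = 0.
  by have := linL (-1) 0 0; rewrite scaler0 addr0 scaleN1r addNr.
have LD u v : L (u + v) = L u + L v by have := linL 1 u v; rewrite !scale1r.
have LZ a v : L (a *: v) = a *: L v by have := linL a v 0; rewrite L0 !addr0.
apply: lspan_min => //; split; first by rewrite /= L0.
  by move=> u v /= Uu Uv; rewrite /= LD; apply: UD.
by move=> a u /= Uu; rewrite /= LZ; apply: UZ.
Qed.

Section InvariantPowers.
Variables (K : numFieldType) (n : nat).
Local Notation P := {mpoly K[n]}.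
Implicit Types (f g h p q r b : P) (a c : K) (s : 'S_n) (S : set P).

Definition pos_inv : set P :=
  [set f | [/\ diff_poly f, f \is symmetric
    & exists2 d : nat, (0 < d)%N & f \is d.-homog]].

Fixpoint inv_prod (j : nat) : set P :=
  if j is j'.+1 then
    [set p | exists f g, [/\ pos_inv f, inv_prod j' g & p = f * g]]
  else [set 1].

(* [inv_span diff_poly j] is the ideal power a^j, and [inv_span sym_diff_poly j]
   its analogue in the ring of invariants. *)
Definition inv_span S (j : nat) : set P :=
  lspan [set p | exists r q, [/\ S r, inv_prod j q & p = r * q]].

Definition sym_diff_poly : set P := [set f | diff_poly f /\ f \is symmetric].

Lemma inv_prod_sym_diff j q : inv_prod j q -> sym_diff_poly q.
Proof.
elim: j q => [|j IHj] q /=; first by move=> ->; split;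
  [exact: diff_poly1 | exact: rpred1].
move=> [f [g [[fd fs _] /IHj[gd gs] ->]]].
by split; [exact: diff_polyM | exact: rpredM].
Qed.

Lemma inv_span_in S j r q : S r -> inv_prod j q -> inv_span S j (r * q).
Proof. by move=> Sr qj; apply: lspan_in; exists r, q. Qed.

Lemma inv_span_subspace S j : is_subspace (inv_span S j).
Proof. exact: lspan_subspace. Qed.

Lemma inv_span_mono S S' j : S `<=` S' -> inv_span S j `<=` inv_span S' j.
Proof.
by move=> SS'; apply: lspan_mono => p [r [q [/SS' Sr qj ->]]]; exists r, q.
Qed.

Lemma inv_span_diff j b : inv_span (@diff_poly K n) j b -> diff_poly b.
Proof.
apply: lspan_min; first exact: diff_poly_subspace.
by move=> p [r [q [rd /inv_prod_sym_diff[qd _] ->]]]; apply: diff_polyM.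
Qed.

Lemma inv_spanM S j f b : (forall r, S r -> S (f * r)) ->
  inv_span S j b -> inv_span S j (f * b).
Proof.
move=> Sf; apply: (lspan_linear (L := fun b => f * b)).
- by move=> a g h; rewrite mulrDr scalerAr.
- exact: inv_span_subspace.
by move=> _ [r [q [Sr qj ->]]]; rewrite mulrA; apply: inv_span_in => //;
  apply: Sf.
Qed.

Lemma inv_span_pos_inv S j f b : pos_inv f -> inv_span S j b ->
  inv_span S j.+1 (f * b).
Proof.
move=> fi; apply: (lspan_linear (L := fun b => f * b)).
- by move=> a g h; rewrite mulrDr scalerAr.
- exact: inv_span_subspace.
by move=> _ [r [q [Sr qj ->]]]; rewrite mulrCA; apply: inv_span_in => //;
  exists f, q.
Qed.

Lemma inv_span_msym s j b : inv_span (@diff_poly K n) j b ->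
  inv_span (@diff_poly K n) j (msym s b).
Proof.
apply: (lspan_linear (L := msym s)); first exact: linearP.
  exact: inv_span_subspace.
move=> _ [r [q [rd qj ->]]]; rewrite msymM.
have [_ /issymP ->] := inv_prod_sym_diff qj.
by apply: inv_span_in => //; apply: diff_poly_msym.
Qed.

Lemma inv_span_mderiv j q i : inv_prod j q ->
  inv_span (@diff_poly K n) j.-1 q^`M(i).
Proof.
elim: j q => [|j IHj] q /=.
  by move=> ->; rewrite mderivC; apply: lspan0.
move=> [f [g [fi gj ->]]]; rewrite mderivM; apply: lspanD.
  by apply: inv_span_in => //; case: fi => fd _ _; apply: diff_poly_mderiv.
case: j => [|j] in gj IHj *; last exact/inv_span_pos_inv/IHj.
by rewrite gj mderivC mulr0; apply: lspan0.
Qed.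

Lemma inv_prod_pred j q : inv_prod j q -> inv_span (@diff_poly K n) j.-1 q.
Proof.
case: j => [|j] /= => [->|[f [g [[fd _ _] gj ->]]]]; last exact: inv_span_in.
by rewrite -[1]mulr1; apply: inv_span_in => //; apply: diff_poly1.
Qed.

(** For invariant q, [D_i] acts on r q by the Leibniz rule, with a plain derivative on q;
    differentiating a product of j invariants leaves j - 1 of them intact. *)
Lemma inv_span_dunkl c i j b : inv_span (@diff_poly K n) j b ->
  inv_span (@diff_poly K n) j.-1 (dunkl_op c i b).
Proof.
apply: (lspan_linear (L := dunkl_op c i)); first exact: linearP.
  exact: inv_span_subspace.
move=> _ [r [q [rd qj ->]]]; have [qd qs] := inv_prod_sym_diff qj.
rewrite dunkl_opM_sym //; apply: lspanD; apply: inv_spanM.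
- by move=> f fd; apply: diff_polyM => //; apply: diff_poly_dunkl.
- exact: inv_prod_pred.
- by move=> f; apply: diff_polyM.
- exact: inv_span_mderiv.
Qed.

(** A symmetric linear form has equal coefficients, and translation invariance makes their sum 0. *)
Lemma pos_inv_degree f : (0 < n)%N -> pos_inv f ->
  exists2 d, (2 <= d)%N & f \is d.-homog.
Proof.
move=> n_gt0 [fd /issymP fs [[//|[|d]] _ fh]]; last by exists d.+2.
suff -> : f = 0 by exists 2 => //; apply: rpred0.
have fU i j : f@_U_(i) = f@_U_(j).
  rewrite -{1}(fs (tperm i j)) mcoeff_sym; congr (f@_ _); apply/mnmP => k.
  rewrite mnmE !mnm1E; congr (nat_of_bool _).
  by rewrite -(inj_eq (@perm_inj _ (tperm i j))) tpermK tpermL.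
have f0 i : f@_U_(i) = 0.
  have /(congr1 (mcoeff 0%MM)) := diff_poly_sum_mderiv fd.
  rewrite raddf_sum mcoeff0 /=.
  rewrite (eq_bigr (fun=> f@_U_(i))) => [|k _]; last first.
    by rewrite mcoeff_deriv add0m mnm0E mulr1n; apply: fU.
  by rewrite sumr_const card_ord => /eqP;
    rewrite mulrn_eq0 eqn0Ngt n_gt0 => /eqP.
apply/mpolyP => u; rewrite mcoeff0; have [uf|] := boolP (u \in msupp f);
  last first.
  by move/memN_msupp_eq0.
have /mdeg1P[i /eqP ->] : mdeg u == 1%N by apply/eqP; exact: (dhomogP _ _ _ fh).
exact: f0.
Qed.

Lemma inv_prod_degree j q : (0 < n)%N -> inv_prod j q ->
  exists2 d, (2 * j <= d)%N & q \is d.-homog.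
Proof.
move=> n_gt0; elim: j q => [|j IHj] q /=.
  by move=> ->; exists 0%N => //; apply: dhomog1.
move=> [f [g [/(pos_inv_degree n_gt0)[d d2 fd] /IHj[e e2 ge] ->]]].
by exists (d + e)%N; [rewrite mulnS leq_add | exact: dhomogM].
Qed.

Lemma inv_span_low S j d b : (0 < n)%N -> (d < 2 * j)%N -> inv_span S j b ->
  b \is d.-homog -> b = 0.
Proof.
move=> n_gt0 dj bj bd; rewrite -(pihomog_dE bd).
have set0_sub : is_subspace [set 0 : P].
  split => //=; first by move=> u v -> ->; rewrite addr0.
  by move=> a u ->; rewrite scaler0.
apply: (lspan_linear (L := pihomog mdeg d) (linearP _) set0_sub _ bj).
move=> _ [r [q [_ /(inv_prod_degree n_gt0)[e ej qe] ->]]] /=.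
by rewrite (pihomogM _ _ qe) leqNgt (leq_trans dj ej).
Qed.

Lemma inv_span_pihomog S j d b : (forall e r, S r -> S (pihomog mdeg e r)) ->
  (0 < n)%N -> inv_span S j b -> inv_span S j (pihomog mdeg d b).
Proof.
move=> Sh n_gt0; apply: (lspan_linear (L := pihomog mdeg d));
  first exact: linearP.
  exact: inv_span_subspace.
move=> _ [r [q [Sr qj ->]]]; have [e _ qe] := inv_prod_degree n_gt0 qj.
rewrite (pihomogM _ _ qe); case: ifP => _; last exact: lspan0.
by apply: inv_span_in => //; apply: Sh.
Qed.

Lemma sym_diff_poly_pihomog d r : sym_diff_poly r ->
  sym_diff_poly (pihomog mdeg d r).
Proof.
by move=> [rd rs]; split; [exact: diff_poly_pihomog | exact: pihomog_sym].
Qed.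

(** For S = [diff_poly] this is the set A i of the overview; for S = [sym_diff_poly] it is the
    analogue for e L, on which the induction runs. Slope and shift are separate parameters because
    multiplication by W raises the first by 1 and the second by deg W. *)
Definition annih c (sh : nat) S (i : int) : set P :=
  [set f | diff_poly f /\ forall (j d : nat) b, inv_span S j b ->
    b \is d.-homog ->
     d%:Z - sh%:Z < 2 * j%:Z - i -> dunkl_pair c f b = 0].

Variables (c : K) (sh : nat).

Lemma annih_subspace S i : is_subspace (annih c sh S i).
Proof.
split; first by split=> [|j d b _ _ _]; [exact: diff_poly0 |
  by rewrite -(scale0r 0) dunkl_pairZl mul0r].
- move=> f g [fd fA] [gd gA]; split=> [|j d b bj bd lt];
  first exact: diff_polyD.
  by rewrite dunkl_pairDl (fA j d) // (gA j d) // addr0.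
- move=> a f [fd fA]; split=> [|j d b bj bd lt]; first exact: diff_polyZ.
  by rewrite dunkl_pairZl (fA j d) // mulr0.
Qed.

Lemma annih_le S i i' : i <= i' -> annih c sh S i `<=` annih c sh S i'.
Proof.
move=> ii' f [fd fA]; split=> // j d b bj bd lt; apply: (fA j d) => //.
by lia.
Qed.

Lemma annih_mono S S' i : S `<=` S' -> annih c sh S' i `<=` annih c sh S i.
Proof.
move=> SS' f [fd fA]; split=> // j d b bj; apply: fA.
exact: inv_span_mono bj.
Qed.

Local Notation A := (annih c sh (@diff_poly K n)).

Lemma annih_msym s i f : A i f -> A i (msym s f).
Proof.
move=> [fd fA]; split=> [|j d b bj bd lt]; first exact: diff_poly_msym.
rewrite -(dunkl_pair_msym c s^-1) -msymMm mulgV msym1m.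
by apply: (fA j d) => //; [exact: inv_span_msym | exact: dhomog_msym].
Qed.

(** The adjoint [D_e] lowers both the degree and j by 1, so 2j minus the degree drops by 1, as i
    grows by 1. *)
Lemma annih_X i k l f : A i f -> A (i + 1) (('X_k - 'X_l) * f).
Proof.
move=> [fd fA]; split=> [|j d b bj bd lt].
  by apply: diff_polyM => //; apply: diff_polyX.
have D0 e : dunkl_pair c f (dunkl_op c e b) = 0.
  case: d => [|d] in bd lt *.
    by rewrite dunkl_op_homog0 // -(scale0r 0) dunkl_pairZr mul0r.
  apply: (fA j.-1 d); [exact: inv_span_dunkl | exact: dhomog_dunkl_op |].
  (* For j = 0, where [j.-1] is truncated, the inequality holds with room to spare. *)
  by case: (j) lt => [|j'] /=; lia.
by rewrite mulrBl -scaleN1r dunkl_pairDl dunkl_pairZl !dunkl_pairXl !D0 mulr0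
  addr0.
Qed.

(** The adjoint, multiplication by a difference, keeps the power j and raises the degree by 1. *)
Lemma annih_Y i k l f : A i f -> A (i + 1) (dunkl_op c k f - dunkl_op c l f).
Proof.
move=> [fd fA]; split=> [|j d b bj bd lt].
  by apply: diff_polyB; apply: diff_poly_dunkl.
rewrite -scaleN1r dunkl_pairDl dunkl_pairZl -!dunkl_pairXr -dunkl_pairZr
  -dunkl_pairDr.
rewrite scaleN1r -mulrBl; apply: (fA j d.+1); last by lia.
  by apply: inv_spanM => // r; apply/diff_polyM/diff_polyX.
by rewrite -[d.+1]add1n; apply: dhomogM => //; apply: rpredB; apply: dhomogXU.
Qed.

(** A test element would have degree d < 2j, below that of any product of j positive invariants.
    This is the case m = 1. *)
Lemma annih_low i f : (0 < n)%N -> (sh = 0)%N -> 0 <= i -> diff_poly f ->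
  annih c sh sym_diff_poly i f.
Proof.
move=> n_gt0 sh0 i0 fd; split=> // j d b bj bd; rewrite sh0 => lt.
rewrite (inv_span_low n_gt0 _ bj bd); last by lia.
by rewrite -(scale0r 0) dunkl_pairZr mul0r.
Qed.

End InvariantPowers.

(** * Antisymmetrisation and passage to the invariants *)

Section SignAverage.
Variables (K : numFieldType) (n : nat).
Local Notation P := {mpoly K[n]}.
Local Notation W := (vandermonde K n).
Implicit Types (f g h p q r b : P) (a c : K) (s t : 'S_n).

Definition sym_avg f : P := (n`!%:R)^-1 *: \sum_(s : 'S_n) msym s f.

Definition sgn_avg f : P := (n`!%:R)^-1 *: \sum_(s : 'S_n) (-1) ^+ s *: msym s
  f.

Let fact_neq0 : n`!%:R != 0 :> K.
Proof. by rewrite pnatr_eq0 -lt0n fact_gt0. Qed.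

Lemma sym_avg_sym f : sym_avg f \is symmetric.
Proof.
apply/issymP => t; rewrite /sym_avg msymZ (raddf_sum (msym t)) /=;
  congr (_ *: _).
rewrite [RHS](reindex_inj (mulIg t)) /=.
by apply: eq_bigr => s _; rewrite msymMm.
Qed.

Lemma diff_poly_sym_avg f : diff_poly f -> diff_poly (sym_avg f).
Proof. by move=> fd; apply/diff_polyZ/diff_poly_sum => s _;
  apply: diff_poly_msym. Qed.

Lemma sgn_avg_is_linear : linear sgn_avg.
Proof.
move=> a f g; rewrite /sgn_avg scalerA [a * _]mulrC -scalerA -scalerDr;
  congr (_ *: _).
rewrite scaler_sumr -big_split; apply: eq_bigr => s _ /=.
by rewrite linearP /= scalerDr !scalerA mulrC.
Qed.

Lemma sgn_avg_antisym t f : msym t (sgn_avg f) = (-1) ^+ t *: sgn_avg f.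
Proof.
rewrite /sgn_avg msymZ (raddf_sum (msym t)) /= !scalerA [_ * n`!%:R^-1]mulrC
  -scalerA.
congr (_ *: _); rewrite scaler_sumr [RHS](reindex_inj (mulIg t)) /=.
apply: eq_bigr => s _; rewrite msymZ msymMm scalerA; congr (_ *: _).
by rewrite -signr_addb odd_permM addbC -addbA addbb addbF.
Qed.

Lemma diff_poly_sgn_avg f : diff_poly f -> diff_poly (sgn_avg f).
Proof.
move=> fd; apply/diff_polyZ/diff_poly_sum => s _.
exact/diff_polyZ/diff_poly_msym.
Qed.

Lemma sgn_avgM f g : g \is symmetric -> sgn_avg (f * g) = sgn_avg f * g.
Proof.
move=> /issymP gs; rewrite /sgn_avg -scalerAl mulr_suml; congr (_ *: _).
by apply: eq_bigr => s _; rewrite msymM gs scalerAl.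
Qed.

Lemma dhomog_sgn_avg d f : f \is d.-homog -> sgn_avg f \is d.-homog.
Proof.
move=> fd; apply: rpredZ; apply: rpred_sum => s _; apply: rpredZ.
exact: dhomog_msym.
Qed.

Lemma sgn_avg_vandermonde f : diff_poly f ->
  exists2 q, sym_diff_poly q & sgn_avg f = W * q.
Proof.
move=> fd; have [q fE qs] := vandermonde_dvd (sgn_avg_antisym ^~ f).
case: (posnP n) => [n0|n_gt0]; last first.
  exists q => //; split=> //; apply: (diff_poly_divl n_gt0 (vandermonde_neq0 K
    n)).
    exact: diff_poly_vandermonde.
  by rewrite -fE; apply: diff_poly_sgn_avg.
exists q => //; split=> //; rewrite (nvar0_mpolyC_eq q n0); exact: diff_polyC.
Qed.

(** Antisymmetrisation is self-adjoint and acts on W f as symmetrisation of f. *)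
Lemma dunkl_pair_sgn_avg c f b : dunkl_pair c (W * f) (sgn_avg b) =
  dunkl_pair c (W * sym_avg f) b.
Proof.
rewrite /sgn_avg dunkl_pairZr dunkl_pair_sumr.
rewrite /sym_avg -scalerAr dunkl_pairZl [W * (\sum_(s : 'S_n) _)]mulr_sumr
  dunkl_pair_suml; congr (_ * _).
rewrite [RHS](reindex_inj invg_inj) /=; apply: eq_bigr => s _.
rewrite dunkl_pairZr -(dunkl_pair_msym c s^-1) -msymMm mulgV msym1m msymM.
by rewrite msym_vandermonde odd_permV -scalerAl dunkl_pairZl mulrA -signr_addb
  addbb mul1r.
Qed.

Lemma sym_avg_id f : f \is symmetric -> sym_avg f = f.
Proof.
move=> /issymP fs; rewrite /sym_avg; under eq_bigr => s _ do rewrite fs.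
by rewrite sumr_const card_Sn -scaler_nat scalerA mulVf ?scale1r.
Qed.

Lemma dunkl_ev_vandermonde c d b f : b \is symmetric -> b \is d.-homog ->
  f \is symmetric ->
  dunkl_ev (c + 1) b (W * f) = W * dunkl_ev c b f.
Proof.
move=> bs bd fs; pose Rel g g' := g \is symmetric /\ g' = W * g.
have two_neq0 : 2%:R ^+ d * d`!%:R != 0 :> K.
  by rewrite mulf_neq0 ?expf_neq0 ?pnatr_eq0 // -lt0n fact_gt0.
apply: (scalerI two_neq0).
have [] : Rel ((2%:R ^+ d * d`!%:R) *: dunkl_ev c b f)
    (((1 * 2%:R) ^+ d * d`!%:R) *: dunkl_ev (c + 1) b (W * f)).
  apply: dunkl_ev_transfer => //.
  - by move=> g g' h h' [gs ->] [hs ->]; split;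
    [exact: rpredB | rewrite mulrBr].
  - move=> g g' [gs ->]; split; last by rewrite scale1r dunkl_lap_vandermonde.
    by apply/issymP => s; rewrite dunkl_lap_msym (issymP _ gs).
  - by move=> g g' [gs ->]; split; [exact: rpredM | rewrite mulrCA].
by move=> _; rewrite mul1r scalerAr.
Qed.

(* Both sides are evaluated on the constant term of [dunkl_ev c b f], the other
   homogeneous components being killed for degree reasons. *)
Lemma dunkl_pair_vandermonde c d b f : b \is symmetric -> b \is d.-homog ->
  f \is symmetric ->
  dunkl_pair (c + 1) (W * f) (W * b) =
    dunkl_pair (c + 1) W W * dunkl_pair c f b.
Proof.
move=> bs bd fs; rewrite dunkl_pairC [dunkl_pair c f b]dunkl_pairC.
rewrite dunkl_pairE dunkl_evM (dunkl_ev_vandermonde c bs bd fs) -dunkl_pairE.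
rewrite [dunkl_pair c b f]dunkl_pairE; set h := dunkl_ev c b f.
have [N _ WN] := vandermonde_degree K n.
have hE := pihomog_partitionE (leqnSn (mmeasure mdeg h)).
rewrite big_ord_recl /= in hE; set h0 := pihomog mdeg 0 h in hE.
have := dhomog0_const (pihomogP mdeg 0 h); rewrite -/h0 => h0E.
have -> : h.@[fun=> 0] = h0@_0.
  rewrite {1}hE mevalD [X in _ + X](_ : _ = 0); last first.
    rewrite (raddf_sum (meval _)) big1 // => e _.
    by apply: (@meval0_homog _ _ e); apply: pihomogP.
  by rewrite addr0 h0E mevalZ meval1 mulr1 mcoeffZ mcoeff1 eqxx mulr1.
rewrite [in LHS]hE mulrDr dunkl_pairDr [X in _ + X](_ : _ = 0); last first.
  rewrite mulr_sumr dunkl_pair_sumr big1 // => e _.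
  apply: (@dunkl_pair_homog _ _ _ N (N + (bump 0 e))%N) => //.
    by rewrite -[X in X != _]addn0 eqn_add2l.
  by rewrite mulrC addnC; apply: dhomogM => //; apply: pihomogP.
by rewrite addr0 h0E -scalerAr mulr1 dunkl_pairZr mcoeffZ mcoeff1 eqxx mulr1
  mulrC.
Qed.

(** In r q the invariant product q passes through the antisymmetrisation; only r changes, into W
    times an invariant. *)
Lemma inv_span_sgn_avg j b : inv_span (@diff_poly K n) j b ->
  exists2 b', inv_span (@sym_diff_poly K n) j b' & sgn_avg b = W * b'.
Proof.
have sub : is_subspace [set g | exists2 b',
  inv_span (@sym_diff_poly K n) j b' & g = W * b'].
  have [S0 SD SZ] := inv_span_subspace (@sym_diff_poly K n) j; split.
  - by exists 0; rewrite ?mulr0.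
  - by move=> _ _ [g gS ->] [h hS ->]; exists (g + h);
    [exact: SD | rewrite mulrDr].
  - by move=> a _ [g gS ->]; exists (a *: g); [exact: SZ | rewrite scalerAr].
move=> bj; apply: (lspan_linear sgn_avg_is_linear sub _ bj).
move=> _ [r [q [rd qj ->]]]; have [_ qs] := inv_prod_sym_diff qj.
have [r' r'S rE] := sgn_avg_vandermonde rd.
by exists (r' * q); [exact: inv_span_in | rewrite sgn_avgM // rE mulrA].
Qed.

(** Antisymmetrising a test element b changes neither its degree nor its pairing with W f. It
    becomes W b' with b' in the same power j but of degree d - N, and the shift absorbs N. *)
Lemma annih_vandermonde c N sh i f : (0 < n)%N -> W \is N.-homog ->
  f \is symmetric ->
  annih c sh (@sym_diff_poly K n) i f ->
  annih (c + 1) (sh + N)%N (@diff_poly K n) i (W * f).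
Proof.
move=> n_gt0 WN fs [fd fA]; split=> [|j d b bj bd lt].
  by apply: diff_polyM => //; apply: diff_poly_vandermonde.
rewrite -[f in W * f](sym_avg_id fs) -dunkl_pair_sgn_avg.
have [b' b'j bE] := inv_span_sgn_avg bj.
rewrite -(pihomog_dE (dhomog_sgn_avg bd)) bE [W * b']mulrC (pihomogM _ _ WN).
case: leqP => Nd; last by rewrite -(scale0r 0) dunkl_pairZr mul0r.
have b''j : inv_span (@sym_diff_poly K n) j (pihomog mdeg (d - N) b').
  by apply: inv_span_pihomog => // e r; apply: sym_diff_poly_pihomog.
have b''s : pihomog mdeg (d - N) b' \is symmetric.
  apply: pihomog_sym; apply: (lspan_min (U := [set p : P | p \is symmetric]) _
    _ b'j).
    split; [exact: rpred0 | by move=> ? ?; apply: rpredD | by move=> ? ?;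
      apply: rpredZ].
  by move=> _ [r [q [[_ rs] /inv_prod_sym_diff[_ qs] ->]]]; apply: rpredM.
rewrite [_ * W]mulrC (dunkl_pair_vandermonde c b''s (pihomogP _ _ _) fs).
by rewrite (fA j (d - N)%N) ?mulr0 ?pihomogP //; lia.
Qed.

End SignAverage.

(** * Transport of annihilators along the duality *)

Section AnnihilatorDuality.
Variables (K : numFieldType) (n m : nat).
Hypotheses (n_gt0 : (0 < n)%N) (m_gt0 : (0 < m)%N).
Local Notation rel := (@psum_rel K n m).

Lemma psum_rel_pos_inv f : pos_inv f -> exists2 f', rel f f' & pos_inv f'.
Proof.
move=> [fd fs [d d0 fh]]; have [f' ff'] := psum_rel_total m fs fd.
have [_ f's] := psum_rel_sym ff'; have [_ f'd] := psum_rel_diff n_gt0 m_gt0 ff'.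
(* [f'] need not be homogeneous, but its component of degree d is still related to [f]. *)
exists (pihomog mdeg d f').
  by rewrite -(pihomog_dE fh); apply: psum_rel_pihomog.
split; [exact: diff_poly_pihomog | exact: pihomog_sym |].
by exists d => //; apply: pihomogP.
Qed.

Lemma psum_rel_inv_prod j q : inv_prod j q ->
  exists2 q', rel q q' & inv_prod j q'.
Proof.
elim: j q => [|j IHj] q /=.
  by move=> ->; exists 1 => //; rewrite -!mpolyC1; apply: psum_relC.
move=> [f [g [/psum_rel_pos_inv[f' ff' f'i] /IHj[g' gg' g'j] ->]]].
by exists (f' * g'); [exact: psum_relM | exists f', g'].
Qed.

Lemma psum_rel_inv_span j b : inv_span (@sym_diff_poly K n) j b ->
  exists2 b', rel b b' & inv_span (@sym_diff_poly K m) j b'.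
Proof.
have [S0 SD SZ] := inv_span_subspace (@sym_diff_poly K m) j.
apply: (lspan_min (U := [set b | exists2 b',
  rel b b' & inv_span (@sym_diff_poly K m) j b'])).
  split.
  - by exists 0 => //; apply: psum_rel0.
  - move=> g h [g' gg' g'j] [h' hh' h'j].
    by exists (g' + h'); [exact: psum_relD | exact: SD].
  - by move=> a g [g' gg' g'j]; exists (a *: g');
    [exact: psum_relZ | exact: SZ].
move=> _ [r [q [[rd rs] /psum_rel_inv_prod[q' qq' q'j] ->]]].
have [r' rr'] := psum_rel_total m rs rd.
exists (r' * q'); first exact: psum_relM.
have [_ r's] := psum_rel_sym rr'; have [_ r'd] := psum_rel_diff n_gt0 m_gt0 rr'.
exact: inv_span_in.
Qed.

(** Test elements are carried from n to m variables factor by factor, which preserves the power j;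
    taking components preserves the degree. *)
Lemma annih_duality sh i f f' : rel f f' ->
  annih (n%:R / m%:R) sh (@sym_diff_poly K m) i f' ->
  annih (m%:R / n%:R) sh (@sym_diff_poly K n) i f.
Proof.
move=> ff' [f'd f'A]; have [fd _] := psum_rel_diff n_gt0 m_gt0 ff'.
split=> // j d b bj bd lt; have [b' bb' b'j] := psum_rel_inv_span bj.
have := psum_rel_pihomog m_gt0 d bb'; rewrite (pihomog_dE bd) => bb''.
apply: (psum_rel_pair n_gt0 m_gt0 bb'' ff' bd (pihomogP _ _ _)).
apply: (f'A j d) => //; last exact: pihomogP.
by apply: inv_span_pihomog => // e r; apply: sym_diff_poly_pihomog.
Qed.

End AnnihilatorDuality.

(** * The filtrations *)

Section Translation.
Variables (R : realType) (n : nat).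
Local Notation P := {mpoly R[i][n]}.
Implicit Types (f g : P) (c : R[i]) (k l : 'I_n).

Lemma ddiffE k l f : ddiff k l f = divdiff k l f.
Proof. by rewrite divdiff.unlock. Qed.

Lemma dunklE c k f : dunkl c k f = dunkl_op c k f.
Proof.
rewrite dunkl_op.unlock /dunkl; congr (_ + _ *: _).
by apply: eq_bigr => l _; apply: ddiffE.
Qed.

Lemma dunkl_formE c f g : dunkl_form c f g = dunkl_pair c f g.
Proof.
have E : @dunkl R n c = @dunkl_op R[i] n c.
  by apply: boolp.funext => k; apply: boolp.funext => h; apply: dunklE.
rewrite dunkl_pair.unlock dunkl_ev.unlock dunkl_mon.unlock /dunkl_form
  /dunkl_subst.
by rewrite E.
Qed.

Lemma diff_ringE : @diff_ring R n = @diff_poly R[i] n.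
Proof.
apply/seteqP; split=> f; elim.
- exact: diff_polyC.
- exact: diff_polyX.
- by move=> g h _ ? _ ?; apply: diff_polyD.
- by move=> g h _ ? _ ?; apply: diff_polyM.
- exact: diff_ringC.
- exact: diff_ringX.
- by move=> g h _ ? _ ?; apply: diff_ringD.
- by move=> g h _ ? _ ?; apply: diff_ringM.
Qed.

Lemma vanderE : vander R n = vandermonde R[i] n.
Proof. by rewrite vandermonde.unlock. Qed.

Lemma sym_idemE f : sym_idem f = sym_avg f.
Proof. by []. Qed.

Lemma sign_idemE f : sign_idem f = sgn_avg f.
Proof. by []. Qed.

Lemma pos_invariantE : @pos_invariant R n = @pos_inv R[i] n.
Proof. by rewrite /pos_invariant diff_ringE. Qed.

End Translation.

(** * Annihilators and the algebraic filtration *)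

Section Representation.
Variables (R : realType) (m n : nat).
Hypotheses (n_gt0 : (0 < n)%N) (m_gt0 : (0 < m)%N).
Local Notation C := R[i].
Local Notation P := {mpoly C[n]}.
Variable I : set P.
Hypothesis hI : is_Lideal m I.
Local Notation c := (slope R m n).
Local Notation sh := (top_shift m n).
Implicit Types (f g h p q r b : P).

Lemma Lideal_subspace : is_subspace I.
Proof. by case: (Lideal_sub hI). Qed.

Lemma Lideal_diff : I `<=` @diff_poly C n.
Proof. by case: (Lideal_sub hI); rewrite diff_ringE. Qed.

Lemma LidealB f g : I f -> I g -> I (f - g).
Proof.
have [_ ID IZ] := Lideal_subspace => If Ig; rewrite -scaleN1r.
by apply: ID => //; apply: IZ.
Qed.

Lemma Lideal_meval0 f : I f -> f.@[fun=> 0] = 0.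
Proof.
rewrite (Lideal_gen hI).
apply: (lspan_min (U := [set f : P | f.@[fun=> 0] = 0])).
  split=> [|g h /= g0 h0|a g /= g0]; first exact: meval0.
    by rewrite mevalD g0 h0 addr0.
  by rewrite mevalZ g0 mulr0.
move=> _ [r [g [_ _ gm ->]]] /=; rewrite mevalM.
have gm' : g \is m.-1.+1.-homog by rewrite prednK.
by rewrite (@meval0_homog C n _ g gm') mulr0.
Qed.

Lemma Lideal_pihomog d f : I f -> I (pihomog mdeg d f).
Proof.
rewrite (Lideal_gen hI); apply: (lspan_linear (L := pihomog mdeg d)).
- exact: linearP.
- exact: lspan_subspace.
move=> _ [r [g [rd Ig gm ->]]]; rewrite (@pihomogM C n _ _ _ _ gm).
case: ifP => _; last exact: lspan0.
apply: lspan_in; exists (pihomog mdeg (d - m) r), g; split => //.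
by move: rd; rewrite diff_ringE; apply: diff_poly_pihomog.
Qed.

(** For b in the ring of differences b(D) preserves the submodule [I], whose elements have no
    constant term as m > 0. *)
Lemma Lideal_pair f b : I f -> diff_poly b -> dunkl_pair c f b = 0.
Proof.
move=> If bd; rewrite dunkl_pairC dunkl_pairE; apply: Lideal_meval0.
apply: (dunkl_ev_stable Lideal_subspace _ bd If) => k l h Ih.
have [_ _ /(_ (GY k l) _ Ih)] := Lideal_sub hI.
by rewrite /= !dunklE.
Qed.

Lemma Lideal_annih S i : S `<=` @diff_poly C n -> I `<=` annih c sh S i.
Proof.
move=> Sd f If; split=> [|j d b bj bd _]; first exact: Lideal_diff.
by apply: Lideal_pair => //; apply: (@inv_span_diff _ _ j);
  apply: inv_span_mono bj.
Qed.

Lemma coinv_pow_inv_span j : coinv_pow j `<=` inv_span (@diff_poly C n) j.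
Proof.
elim: j => [|j IHj] /=.
  rewrite diff_ringE => r rd; rewrite -[r]mulr1; exact: inv_span_in.
apply: lspan_min; first exact: inv_span_subspace.
move=> _ [f [g [fa /IHj gj ->]]].
apply: (lspan_linear (L := fun f => f * g) _ _ _ fa).
- by move=> a p q; rewrite mulrDl scalerAl.
- exact: inv_span_subspace.
move=> _ [r [q [rd qi ->]]]; rewrite -mulrA; apply: inv_spanM.
  by move=> p; apply: diff_polyM; rewrite -diff_ringE.
by apply: inv_span_pos_inv => //; rewrite -pos_invariantE.
Qed.

Lemma Lgrade_lt (k : int) g :
  lspan (\bigcup_(l in [set l : int | l < k]) Lgrade m I l) g ->
  exists2 h, I (g - h) & forall d, k <= d%:Z - sh%:Z -> pihomog mdeg d h = 0.
Proof.
have [I0 ID IZ] := Lideal_subspace.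
apply: (lspan_min (U := [set g : P | exists2 h, I (g - h) &
  forall d, k <= d%:Z - sh%:Z -> pihomog mdeg d h = 0])).
  split=> [|f1 f2 [h1 If1 h1k] [h2 If2 h2k]|a f [h If hk]].
  - by exists 0; rewrite ?subr0 // => d _; rewrite raddf0.
  - exists (h1 + h2); first by rewrite opprD addrACA; apply: ID.
    by move=> d dk; rewrite raddfD /= h1k // h2k // addr0.
  - exists (a *: h); first by rewrite -scalerBr; apply: IZ.
    by move=> d dk; rewrite linearZ /= hk // scaler0.
move=> f [l /= lk [h [hd hl] Ifh]]; exists h => // d dk.
rewrite pihomogE big_seq_cond big1 // => u /andP[/hl ul /eqP ud].
by move: lk; rewrite -ul ud; lia.
Qed.

(** A test class has two representatives modulo [I]: a in the j-th power of the ideal and h of low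
    degree. Components of a in low degree are orthogonal to f by assumption; those in high degree
    lie in [I], because [I] is homogeneous and h has none. *)
Lemma annih_alg_filt i : annih c sh (@diff_poly C n) i `<=` alg_filt m I i.
Proof.
move=> f [fd fA]; split; first by rewrite diff_ringE.
move=> g; rewrite dunkl_formE;
  apply: (lspan_min (U := [set g | dunkl_pair c f g = 0])).
  split=> [|g1 g2 /= H1 H2|a g1 /= H1].
  - by rewrite /= -(scale0r 0) dunkl_pairZr mul0r.
  - by rewrite dunkl_pairDr H1 H2 addr0.
  - by rewrite dunkl_pairZr H1 mulr0.
move=> {}g [j _ [[a aj Iga] /Lgrade_lt[h Igh hj]]] /=.
have -> : g = a + (g - a) by rewrite addrC subrK.
rewrite dunkl_pairDr [X in _ + X]dunkl_pairC (Lideal_pair Iga fd) addr0.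
have ajs := coinv_pow_inv_span aj.
rewrite (pihomog_partitionE (leqnn (mmeasure mdeg a))) dunkl_pair_sumr big1 //
  => d _.
have [dj|dj] := boolP (d%:Z - sh%:Z < 2 * j%:Z - i).
  apply: (fA j d) => //; last exact: pihomogP.
  by apply: inv_span_pihomog => // e r; apply: diff_poly_pihomog.
rewrite dunkl_pairC; apply: Lideal_pair => //.
have Iah : I (a - h).
  have -> : a - h = (g - h) - (g - a) by ring.
  exact: LidealB.
by have := Lideal_pihomog d Iah; rewrite raddfB /= hj ?subr0 //; lia.
Qed.

Lemma annih_word i w f : annih c sh (@diff_poly C n) i f ->
  annih c sh (@diff_poly C n) ((sumn (map (@gen_deg n) w))%:Z + i) (foldr
    (gen_act c) f w).
Proof.
move=> fA; elim: w => [|[s|k l|k l] w IHw] /=; first by rewrite add0r.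
- by rewrite add0n; apply: annih_msym.
- by apply: (annih_le _ (annih_X _ _ IHw)); lia.
- by rewrite !dunklE; apply: (annih_le _ (annih_Y _ _ IHw)); lia.
Qed.

Lemma annih_ch_act (a : nat) i (e : ch_elt R n) f : ch_filt a e ->
  annih c sh (@diff_poly C n) i f ->
  annih c sh (@diff_poly C n) (a%:Z + i) (ch_act c e f).
Proof.
move=> ea fA; have [A0 AD AZ] := annih_subspace c sh (@diff_poly C n) (a%:Z +
  i).
rewrite /ch_act; elim: e ea => [|w e IHe] /=; first by rewrite big_nil.
move=> /andP[wa ea]; rewrite big_cons; apply: AD; last exact: IHe.
by apply/AZ/(annih_le _ (annih_word w.2 fA)); rewrite lerD2r lez_nat.
Qed.

End Representation.

Lemma psum_rel_canon_iso (R : realType) (m n : nat) (I : set {mpoly R[i][n]})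
    (I' : set {mpoly R[i][m]}) f f' :
  @psum_rel R[i] n m f f' -> canon_iso I I' f f'.
Proof.
elim=> [k k0|a|g h g' h' _ gg' _ hh'|g h g' h' _ gg' _ hh'].
- exact: canon_gen.
- exact: canonC.
- exact: canonD.
- exact: canonM.
Qed.

Lemma coprime_subl (m n : nat) : (n <= m)%N -> coprime (m - n) n = coprime m n.
Proof.
by move=> nm; rewrite ![coprime _ n]coprime_sym /coprime -[in RHS](subnK nm)
  gcdnDr.
Qed.

Lemma top_shift_double (m n : nat) : coprime m n -> (0 < m)%N -> (0 < n)%N ->
  (2 * top_shift m n = m.-1 * n.-1)%N.
Proof.
move=> co m0 n0; rewrite /top_shift mul2n; apply: even_halfK.
rewrite oddM; case: m n m0 n0 co => // m [//|n] _ _ /= co;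
  apply/negP => /andP[om on].
have : (2 %| gcdn m.+1 n.+1)%N by rewrite dvdn_gcd !dvdn2 /= om on.
by rewrite (eqP co).
Qed.

Lemma top_shiftC (m n : nat) : top_shift m n = top_shift n m.
Proof. by rewrite /top_shift mulnC. Qed.

(** * Induction on m + n *)

Section Induction.
(* Otherwise [n] would be implicit in [I m n], [F m n i] and [E m n i]. *)
Unset Implicit Arguments.
Variables (R : realType) (I : poly_family R) (F E : filt_family R).
Set Implicit Arguments.
Hypothesis hI : forall m n : nat, (1 < n)%N -> (0 < m)%N -> coprime m n ->
  is_Lideal m (I m n).
Hypothesis hF : inductive_filtration I F E.
Local Notation C := R[i].

(** By condition (3) the step is spanned modulo the ideal by elements h e_- v; annihilators absorb h
    at the cost of its filtration degree, and e_- v = W q with q in [E (m - n) n] by condition (2).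
    The assumption on (m - n, n) stays explicit so that the lemma serves both inside the induction
    and after it. *)
Lemma filtration_step m n i : (1 < n)%N -> (n < m)%N -> coprime m n ->
  (forall j, E (m - n)%N n j `<=`
     annih (slope R (m - n)%N n) (top_shift (m - n)%N n) (@sym_diff_poly C n)
       j) ->
  F m n i `<=` annih (slope R m n) (top_shift m n) (@diff_poly C n) i.
Proof.
move=> n1 nm co IH; have n0 := ltnW n1;
  have m0 : (0 < m)%N by apply: leq_trans nm.
have hImn := hI n1 m0 co; have [filtF _] := ind_compatible hF n1 nm co.
have [_ AD _] := annih_subspace (slope R m n) (top_shift m n) (@diff_poly C n)
  i.
have mn0 : (0 < m - n)%N by rewrite subn_gt0.
have co' : coprime (m - n) n by rewrite coprime_subl // ltnW.
rewrite (ind_tensor hF n1 nm co) => f [p pS Ifp].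
have -> : f = p + (f - p) by rewrite addrC subrK.
apply: AD; last exact: (Lideal_annih m0 hImn i (fun _ H => H) Ifp).
apply: (lspan_min (annih_subspace _ _ _ _) _ pS) =>
  _ [a [b [h [v [<- ha Fv [vd Iv] ->]]]]].
apply: annih_ch_act => //.
have [_ FD _] := filt_subspace filtF b.
(* [v] and [sign_idem v] differ by an element of the ideal, which every step contains. *)
have {}Fv : F m n b (sign_idem v).
  have -> : sign_idem v = v + (sign_idem v - v) by rewrite addrC subrK.
  by apply: FD => //; apply: (filt_ideal filtF).
move: vd Fv; rewrite diff_ringE sign_idemE =>
  /sgn_avg_vandermonde[q [qd qs] ->].
have shift := ind_shift hF n1 mn0 co'; rewrite subnK ?(ltnW nm) // in shift.
rewrite -vanderE -(shift q) ?diff_ringE // => /IH.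
have [N N2 WN] := vandermonde_degree C n.
move=> /(annih_vandermonde n0 WN qs).
have -> : slope R (m - n)%N n + 1 = slope R m n.
  rewrite /slope natrB ?(ltnW nm) // mulrBl divff ?subrK //.
  by rewrite pnatr_eq0 -lt0n.
(* In doubled form: (m-n-1)(n-1) + n(n-1) = (m-1)(n-1). *)
have -> : (top_shift (m - n) n + N)%N = top_shift m n.
  have := top_shift_double co m0 n0; have := top_shift_double co' mn0 n0.
  move: N2 nm n1 m0 mn0; clear; nia.
by rewrite vanderE.
Qed.

(** For m > n, restriction and [filtration_step] lead to (m - n, n); for m < n, duality comes first
    and the pair becomes (n - m, m). The descent ends at m = 1. *)
Lemma spherical_step m n i : (1 < n)%N -> (0 < m)%N -> coprime m n ->
  E m n i `<=` annih (slope R m n) (top_shift m n) (@sym_diff_poly C n) i.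
Proof.
have [N] := ubnP (m + n); elim: N m n i => // N IHN m n i.
rewrite ltnS => mnN n1 m0 co; have n0 := ltnW n1.
have hImn := hI n1 m0 co; have [filtE _] := ind_sph_compatible hF n1 m0 co.
have sd k : @sym_diff_poly C k `<=` @diff_poly C k by move=> f [].
(* The bound [l + k <= N] admits both (m, n) and its swap: the induction hypothesis is used at (l -
   k, k), whose sum is l. *)
have Fle k l j : (1 < k)%N -> (k < l)%N -> coprime l k -> (l + k <= N)%N ->
    E l k j `<=` annih (slope R l k) (top_shift l k) (@sym_diff_poly C k) j.
  move=> k1 kl lk lkN f; rewrite (ind_restrict hF k1 kl lk) => -[Ff _].
  apply: annih_mono (sd k) _ _; apply: filtration_step Ff => // e.
  apply: IHN => //; rewrite ?subn_gt0 //; first by rewrite subnK ?(ltnW kl) //;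
    lia.
  by rewrite coprime_subl // ltnW.
have [m1|] := leqP m 1; last first.
  case: (ltngtP m n) => [mn m1|nm _|mE m1].
  - move=> f Ef; have [fd If] := filt_sub filtE Ef.
    have [_ ED _] := filt_subspace filtE i.
    have [_ AD _] := annih_subspace (slope R m n) (top_shift m n)
      (@sym_diff_poly C n) i.
    (* An element of e L is symmetric only modulo the ideal, whereas the power sum correspondence
       needs a symmetric representative. *)
    have E0 : E m n i (sym_idem f).
      have -> : sym_idem f = f + (sym_idem f - f) by rewrite addrC subrK.
      by apply: ED => //; apply: (filt_ideal filtE).
    have -> : f = sym_idem f + (f - sym_idem f) by rewrite addrC subrK.
    apply: AD; last first.
      apply: (Lideal_annih m0 hImn i (@sd n)).
      by rewrite -opprB -scaleN1r; have [_ _] := Lideal_subspace hImn; apply.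
    move: E0 fd; rewrite diff_ringE sym_idemE => E0 fd.
    have [f' ff'] := psum_rel_total m (sym_avg_sym f) (diff_poly_sym_avg fd).
    apply: (annih_duality n0 m0 ff'); rewrite top_shiftC.
    apply: Fle => //; first by rewrite coprime_sym.
      by rewrite addnC.
    by apply/(ind_duality hF n1 m1 co (psum_rel_canon_iso _ _ ff')).
  - exact: Fle.
  - by move: co; rewrite mE /coprime gcdnn eqn_leq leqNgt n1.
have mE : m = 1%N by apply/eqP; rewrite eqn_leq m1.
subst m; have [EI _] := ind_base hF n1.
(* For i < 0 the step lies in the step -1, which is zero in the quotient; for i >= 0 degrees
   suffice, the shift being 0. *)
have [i0|i0] := boolP (0 <= i) => f Ef.
  apply: annih_low => //; have [fd _] := filt_sub filtE Ef.
  by move: fd; rewrite diff_ringE.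
apply: (Lideal_annih m0 hImn i (@sd n)); rewrite -EI.
by apply: (filt_increasing filtE _ Ef); lia.
Qed.

End Induction.

Theorem theorem4p8 (R : realType) (I : poly_family R) (F E : filt_family R)
  (hI : forall m n : nat, (1 < n)%N -> (0 < m)%N -> coprime m n ->
    is_Lideal m (I m n))
  (hF : inductive_filtration I F E)
  (m n : nat) (hn : (1 < n)%N) (hmn : (n < m)%N) (hco : coprime m n) (i : int) :
  F m n i `<=` alg_filt m (I m n) i.
Proof.
have n0 := ltnW hn; have m0 : (0 < m)%N by apply: leq_trans hmn.
move=> f Ff; have fA : annih (slope R m n) (top_shift m n) (@diff_poly R[i] n)
  i f.
  apply: (filtration_step hI hF) Ff => // j;
    apply: (spherical_step hI hF) => //.
    by rewrite subn_gt0.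
  by rewrite coprime_subl // ltnW.
exact: (annih_alg_filt n0 m0 (hI m n hn m0 hco) fA).
Qed.
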